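(* Let $p$ be a prime, let $G\ne\{1\}$ be a finite $p$-group and $\Lambda:=\mathbb Z_pG$. Let $\Gamma:=\mathrm{Id}(J(\Lambda))$. 1) $\Gamma$ is hereditary if and only if $G\cong C_p$. 2) Assume that $|G|\ge p^2$. Then $\Delta:=\mathrm{Id}(J(\Gamma))$ is hereditary if and only if $|G|=4$.
   Context: $\mathbb Z_p$ is the ring of $p$-adic integers, $C_p$ the cyclic group of order $p$. Orders are $\mathbb Z_p$-orders in $\mathbb Q_pG$; $J(\cdot)$ is the Jacobson radical. For a full lattice $L$ in $\mathbb Q_pG$, $\mathrm{Id}(L)=\{a\in\mathbb Q_pG: aL\subseteq L,\ La\subseteq L\}$. An order is hereditary if each of its left ideals is projective. *)

(* Defs.v *)
From HB Require Import structures.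
From mathcomp Require Import all_boot all_order all_algebra.
From mathcomp Require Import all_fingroup all_solvable.
From mathcomp Require Import boolp.

Set Implicit Arguments.
Unset Strict Implicit.
Unset Printing Implicit Defensive.

Import GRing.Theory.
Local Open Scope ring_scope.

(******************************************************************************)
(* The p-adic integers, as the inverse limit of the rings Z/p^n: an element   *)
(* is the sequence (x_n) of its canonical representatives, 0 <= x_n < p^n.    *)
(* Both the range and the compatibility of the x_n are contained in the       *)
(* single condition x_n = x_(n+1) mod p^n.                                    *)
(* The primality proof is a parameter of the type so that the integral domain *)
(* structure, hence the fraction field, can be inferred.                      *)
(******************************************************************************)

Record padic_int (p : nat) (p_pr : prime p) := PadicInt {
  padic_seq :> nat -> nat;
  padic_seqP : forall n, padic_seq n = (padic_seq n.+1 %% p ^ n)%N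
}.

Section PadicInt.
Variables (p : nat) (p_pr : prime p).
Local Notation Z_p := (padic_int p_pr).
Implicit Types x y z : Z_p.

HB.instance Definition _ := gen_eqMixin Z_p.
HB.instance Definition _ := gen_choiceMixin Z_p.

Lemma padicP x y : (forall n, x n = y n) -> x = y.
Proof.
case: x y => [x xP] [y yP] /= /funext exy.
by case: _ / exy yP => yP; rewrite (Prop_irrelevance xP yP).
Qed.

Lemma padic_mod x n : (x n %% p ^ n)%N = x n.
Proof. by rewrite (padic_seqP x n) modn_mod. Qed.

Lemma padic_modD x n k : (x (n + k) %% p ^ n)%N = x n.
Proof.
elim: k => [|k IHk]; first by rewrite addn0 padic_mod.
rewrite -IHk addnS (padic_seqP x (n + k)) modn_dvdm //.
by rewrite expnD dvdn_mulr.
Qed.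

Lemma padic_ofP (f : nat -> nat) :
    (forall n, f n.+1 = f n %[mod p ^ n]) ->
  forall n, (f n %% p ^ n = (f n.+1 %% p ^ n.+1) %% p ^ n)%N.
Proof.
by move=> fP n; rewrite [RHS]modn_dvdm ?fP // expnS dvdn_mull.
Qed.

Definition padic_of (f : nat -> nat)
    (fP : forall n, f n.+1 = f n %[mod p ^ n]) : Z_p :=
  PadicInt p_pr (padic_ofP fP).

Lemma padic_modS x n : x n.+1 = x n %[mod p ^ n].
Proof. by rewrite -padic_seqP padic_mod. Qed.

Definition padic0 : Z_p := @padic_of (fun=> 0%N) (fun=> erefl).
Definition padic1 : Z_p := @padic_of (fun=> 1%N) (fun=> erefl).

Lemma padic_addP x y n : (x n.+1 + y n.+1 = x n + y n %[mod p ^ n])%N.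
Proof. by rewrite -modnDm !padic_modS modnDm. Qed.
Definition padic_add x y : Z_p := padic_of (padic_addP x y).

Lemma padic_mulP x y n : (x n.+1 * y n.+1 = x n * y n %[mod p ^ n])%N.
Proof. by rewrite -modnMm !padic_modS modnMm. Qed.
Definition padic_mul x y : Z_p := padic_of (padic_mulP x y).

Lemma padic_pn n : (0 < p ^ n)%N.
Proof. by rewrite expn_gt0 prime_gt0. Qed.

Lemma padic_ltn x n : (x n < p ^ n)%N.
Proof. by rewrite -padic_mod ltn_mod padic_pn. Qed.

Lemma padic_oppP x n :
  (p ^ n.+1 - x n.+1 = p ^ n - x n %[mod p ^ n])%N.
Proof.
apply/eqP; rewrite -(eqn_modDr (x n.+1)) subnK; last exact/ltnW/padic_ltn.
rewrite -modnDmr padic_modS modnDmr subnK; last exact/ltnW/padic_ltn.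
by rewrite expnS modnMl modnn.
Qed.
Definition padic_opp x : Z_p := padic_of (padic_oppP x).

Lemma padic_addA : associative padic_add.
Proof. by move=> x y z; apply: padicP => n /=; rewrite modnDml modnDmr addnA. Qed.
Lemma padic_addC : commutative padic_add.
Proof. by move=> x y; apply: padicP => n /=; rewrite addnC. Qed.
Lemma padic_add0 : left_id padic0 padic_add.
Proof. by move=> x; apply: padicP => n /=; rewrite mod0n add0n padic_mod. Qed.
Lemma padic_addN : left_inverse padic0 padic_opp padic_add.
Proof.
move=> x; apply: padicP => n /=; rewrite modnDml subnK ?modnn ?mod0n //.
exact/ltnW/padic_ltn.
Qed.

HB.instance Definition _ :=
  GRing.isZmodule.Build Z_p padic_addA padic_addC padic_add0 padic_addN.

Lemma padic_mulA : associative padic_mul.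
Proof. by move=> x y z; apply: padicP => n /=; rewrite modnMml modnMmr mulnA. Qed.
Lemma padic_mulC : commutative padic_mul.
Proof. by move=> x y; apply: padicP => n /=; rewrite mulnC. Qed.
Lemma padic_mul1 : left_id padic1 padic_mul.
Proof. by move=> x; apply: padicP => n /=; rewrite modnMml mul1n padic_mod. Qed.
Lemma padic_mulDl : left_distributive padic_mul padic_add.
Proof.
by move=> x y z; apply: padicP => n /=; rewrite modnMml modnDm mulnDl.
Qed.
Lemma padic1_neq0 : padic1 != 0.
Proof.
apply/eqP => /(congr1 (fun x : Z_p => x 1%N)) /=.
by rewrite expn1 modn_small ?mod0n // prime_gt1.
Qed.

HB.instance Definition _ := GRing.Zmodule_isComNzRing.Build Z_p
  padic_mulA padic_mulC padic_mul1 padic_mulDl padic1_neq0.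

Definition padic_unit : {pred Z_p} := fun x => `[< exists y, y * x = 1 >].

Definition padic_inv x : Z_p :=
  if pselect (exists y, y * x = 1) is left ex then sval (cid ex) else x.

Lemma padic_mulVx : {in padic_unit, left_inverse 1 padic_inv *%R}.
Proof.
move=> x /asboolP ux; rewrite /padic_inv.
by case: pselect => // ex; case: cid.
Qed.

Lemma padic_unitPl x y : y * x = 1 -> padic_unit x.
Proof. by move=> yx; apply/asboolP; exists y. Qed.

Lemma padic_inv_out : {in [predC padic_unit], padic_inv =1 id}.
Proof.
move=> x /negP nux; rewrite /padic_inv; case: pselect => // ex.
by case: nux; apply/asboolP.
Qed.

HB.instance Definition _ := GRing.ComNzRing_hasMulInverse.Build Z_p
  padic_mulVx padic_unitPl padic_inv_out.

Lemma padic_neq0 x : x != 0 -> exists n, x n != 0%N.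
Proof.
move=> x0; apply: contrapT => nx; case/eqP: x0; apply: padicP => n /=.
by rewrite mod0n; apply: contrapT => xn; apply: nx; exists n; apply/eqP.
Qed.

Lemma padic_logn x n k : x n != 0%N ->
  (0 < x (n + k))%N /\ (logn p (x (n + k)) < n)%N.
Proof.
move=> xn0; have x_gt0 : (0 < x (n + k))%N.
  by rewrite lt0n; apply: contraNneq xn0 => x0; rewrite -(padic_modD x n k) x0 mod0n.
by split=> //; rewrite ltnNge -pfactor_dvdn // /dvdn padic_modD.
Qed.

Lemma padic_integral x y : x * y = 0 -> (x == 0) || (y == 0).
Proof.
move=> xy0; apply/norP => -[/padic_neq0[n xn] /padic_neq0[m ym]].
have [x_gt0 ltx] := padic_logn m xn.
have [y_gt0 lty] := padic_logn n ym; rewrite addnC in y_gt0 lty.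
have := congr1 (fun z : Z_p => z (n + m)%N) xy0.
rewrite /= mod0n => /eqP; rewrite -/(dvdn _ _) pfactor_dvdn ?muln_gt0 ?x_gt0 //.
by rewrite lognM // leqNgt -addSn leq_add // ltnW.
Qed.

HB.instance Definition _ :=
  GRing.ComUnitRing_isIntegral.Build Z_p padic_integral.

End PadicInt.

Definition padic (p : nat) (p_pr : prime p) := {fraction padic_int p_pr}.
HB.instance Definition _ p p_pr := GRing.Field.on (@padic p p_pr).

(******************************************************************************)
(* The group algebra, with the convolution product; the element               *)
(* \sum_g a_g g is represented by the function g |-> a_g.                     *)
(******************************************************************************)

Definition group_algebra (R : comNzRingType) (gT : finGroupType) :=
  {ffun gT -> R}.

Section GroupAlgebra.
Variables (R : comNzRingType) (gT : finGroupType).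
Local Notation RG := (group_algebra R gT).
Implicit Types a b c : RG.

HB.instance Definition _ := GRing.Lmodule.copy RG {ffun gT -> R^o}.

Definition galg_one : RG := [ffun g => (g == 1%g)%:R].
Definition galg_mul a b : RG := [ffun g => \sum_h a h * b (h^-1 * g)%g].

Lemma galg_mulA : associative galg_mul.
Proof.
move=> a b c; apply/ffunP => g; rewrite !ffunE.
under eq_bigr do rewrite ffunE big_distrr /=.
under [RHS]eq_bigr do rewrite ffunE big_distrl /=.
rewrite [RHS]exchange_big /=; apply: eq_bigr => h _.
rewrite [RHS](reindex_inj (mulgI h)) /=; apply: eq_bigr => k _.
by rewrite mulrA mulKg invMg mulgA.
Qed.

Lemma galg_mul1l : left_id galg_one galg_mul.
Proof.
move=> a; apply/ffunP => g; rewrite ffunE (bigD1 1%g) //= big1 => [|h /negPf h1].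
  by rewrite ffunE eqxx mul1r invg1 mul1g addr0.
by rewrite ffunE h1 mul0r.
Qed.

Lemma galg_mul1r : right_id galg_one galg_mul.
Proof.
move=> a; apply/ffunP => g; rewrite ffunE (bigD1 g) //= big1 => [|h hg].
  by rewrite ffunE mulVg eqxx mulr1 addr0.
rewrite ffunE; case: eqP => [/(canRL (mulKVg h))|_]; last by rewrite mulr0.
by rewrite mulg1 => gh; rewrite gh eqxx in hg.
Qed.

Lemma galg_mulDl : left_distributive galg_mul +%R.
Proof.
move=> a b c; apply/ffunP => g; rewrite !ffunE -big_split /=.
by apply: eq_bigr => h _; rewrite ffunE mulrDl.
Qed.

Lemma galg_mulDr : right_distributive galg_mul +%R.
Proof.
move=> a b c; apply/ffunP => g; rewrite !ffunE -big_split /=.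
by apply: eq_bigr => h _; rewrite ffunE mulrDr.
Qed.

Lemma galg_one_neq0 : galg_one != 0.
Proof. by apply/eqP => /ffunP/(_ 1%g)/eqP; rewrite !ffunE eqxx oner_eq0. Qed.

HB.instance Definition _ := GRing.Zmodule_isNzRing.Build RG
  galg_mulA galg_mul1l galg_mul1r galg_mulDl galg_mulDr galg_one_neq0.

Lemma galg_scaleAl (k : R) a b : k *: (a * b) = k *: a * b.
Proof.
apply/ffunP => g; rewrite !ffunE scaler_sumr; apply: eq_bigr => h _.
by rewrite ffunE scalerAl.
Qed.

HB.instance Definition _ := GRing.Lmodule_isLalgebra.Build R RG galg_scaleAl.

Lemma galg_scaleAr (k : R) a b : k *: (a * b) = a * (k *: b).
Proof.
apply/ffunP => g; rewrite !ffunE scaler_sumr; apply: eq_bigr => h _.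
by rewrite ffunE; exact: (mulrCA k).
Qed.

HB.instance Definition _ := GRing.Lalgebra_isAlgebra.Build R RG galg_scaleAr.

End GroupAlgebra.

Record submodule (R : nzRingType) (V : lmodType R) (W : submodClosed V) :=
  Submodule { submod_val :> V; submod_valP : submod_val \in W }.

HB.instance Definition _ (R : nzRingType) (V : lmodType R)
    (W : submodClosed V) :=
  [isSub for @submod_val R V W].
HB.instance Definition _ (R : nzRingType) (V : lmodType R)
    (W : submodClosed V) :=
  [Choice of @submodule R V W by <:].
HB.instance Definition _ (R : nzRingType) (V : lmodType R)
    (W : submodClosed V) :=
  [SubChoice_isSubLmodule of @submodule R V W by <:].

Record subring (A : nzRingType) (S : subringClosed A) :=
  Subring { subring_val :> A; subring_valP : subring_val \in S }.

HB.instance Definition _ (A : nzRingType) (S : subringClosed A) :=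
  [isSub for @subring_val A S].
HB.instance Definition _ (A : nzRingType) (S : subringClosed A) :=
  [Choice of @subring A S by <:].
HB.instance Definition _ (A : nzRingType) (S : subringClosed A) :=
  [SubChoice_isSubNzRing of @subring A S by <:].

Definition projective (R : nzRingType) (P : lmodType R) : Prop :=
  forall (M N : lmodType R) (f : {linear M -> N}) (g : {linear P -> N}),
    (forall y, exists x, f x = y) ->
    exists h : {linear P -> M}, forall x, f (h x) = g x.

Notation left_ideal R := (submodClosed R^o).

Definition hereditary (R : nzRingType) : Prop :=
  forall I : left_ideal R, projective (submodule I : lmodType R).

Definition maximal_left_ideal (R : nzRingType) (M : left_ideal R) : Prop :=
  1 \notin M /\
  forall I : left_ideal R, {subset M <= I} -> 1 \notin I -> {subset I <= M}.

Definition jacobson (R : nzRingType) : {pred R} :=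
  fun x => `[< forall M : left_ideal R, maximal_left_ideal M -> x \in M >].
Arguments jacobson R : clear implicits.

Lemma jacobson_zmod_closed (R : nzRingType) : zmod_closed (jacobson R).
Proof.
split=> [|x y /asboolP Jx /asboolP Jy]; apply/asboolP => M maxM.
  exact: (@rpred0 R^o M).
have MNy : (-1 : R) *: (y : R^o) \in M by apply: rpredZ; exact: Jy.
rewrite scaleN1r in MNy; exact: (@rpredD R^o M x (- y) (Jx M maxM) MNy).
Qed.

Section SubringsOfARing.
Variable A : nzRingType.

(* The Jacobson radical of the ring S itself, viewed inside A. *)
Definition jacobson_of_pred (S : subringClosed A) : {pred A} :=
  fun a => `[< exists2 x : subring S, x \in jacobson (subring S) & \val x = a >].

Lemma jacobson_of_zmod_closed S : zmod_closed (jacobson_of_pred S).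
Proof.
have [J0 JB] := jacobson_zmod_closed (subring S).
split=> [|_ _ /asboolP[x Jx <-] /asboolP[y Jy <-]]; apply/asboolP.
  by exists 0.
by exists (x - y); [exact: JB | exact: rmorphB].
Qed.

HB.instance Definition _ S :=
  GRing.isZmodClosed.Build A (jacobson_of_pred S) (jacobson_of_zmod_closed S).

Definition jacobson_of (S : subringClosed A) : zmodClosed A := jacobson_of_pred S.

(* This is Id(L). It is a subring for every additive subgroup L; when L is a  *)
(* full lattice, such as the radical of an order, it is again an order.       *)
Definition idealizer_pred (L : zmodClosed A) : {pred A} :=
  fun a => `[< forall x, x \in L -> a * x \in L /\ x * a \in L >].

Lemma idealizer_subring_closed L : subring_closed (idealizer_pred L).
Proof.
split=> [|a b /asboolP La /asboolP Lb|a b /asboolP La /asboolP Lb].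
- by apply/asboolP => x Lx; rewrite mul1r mulr1.
- apply/asboolP => x Lx; have [ax xa] := La x Lx; have [bx xb] := Lb x Lx.
  by rewrite mulrBl mulrBr !rpredB.
- apply/asboolP => x Lx; have [bx _] := Lb x Lx; have [_ xa] := La x Lx.
  have [abx _] := La _ bx; have [_ xab] := Lb _ xa.
  by split; [rewrite -mulrA | rewrite mulrA].
Qed.

HB.instance Definition _ L :=
  GRing.isSubringClosed.Build A (idealizer_pred L) (idealizer_subring_closed L).

Definition idealizer (L : zmodClosed A) : subringClosed A := idealizer_pred L.

End SubringsOfARing.

Section IntegralGroupRing.
Variables (p : nat) (p_pr : prime p) (gT : finGroupType).
Local Notation QpG := (group_algebra (padic p_pr) gT).

Definition padic_integral_elt : {pred padic p_pr} :=
  fun x => `[< exists z : padic_int p_pr, x = FracField.tofrac z >].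

Lemma padic_integral_subring_closed : subring_closed padic_integral_elt.
Proof.
split=> [|_ _ /asboolP[x ->] /asboolP[y ->]|_ _ /asboolP[x ->] /asboolP[y ->]];
  apply/asboolP.
- by exists 1; rewrite rmorph1.
- by exists (x - y); rewrite rmorphB.
- by exists (x * y); rewrite rmorphM.
Qed.

HB.instance Definition _ := GRing.isSubringClosed.Build _
  padic_integral_elt padic_integral_subring_closed.

Definition ZpG_pred : {pred QpG} :=
  fun a => [forall g, a g \in padic_integral_elt].

Lemma ZpG_subring_closed : subring_closed ZpG_pred.
Proof.
split=> [|a b /forallP Za /forallP Zb|a b /forallP Za /forallP Zb];
  apply/forallP => g; rewrite !ffunE.
- exact: rpred_nat.
- exact: rpredB.
- by apply: rpred_sum => h _; exact: rpredM.
Qed.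

HB.instance Definition _ :=
  GRing.isSubringClosed.Build QpG ZpG_pred ZpG_subring_closed.

Definition ZpG : subringClosed QpG := ZpG_pred.

End IntegralGroupRing.

(* Main.v *)
Require Import Defs.
From HB Require Import structures.
From mathcomp Require Import all_boot all_order all_algebra.
From mathcomp Require Import all_fingroup all_solvable.
From mathcomp Require Import boolp ring.

(* Write s for the sum of all elements of G divided by p.  As Z_p G is local, *)
(* J(Z_p G) consists of the elements whose augmentation is divisible by p,    *)
(* and Gamma = Z_p G + Z_p s.  If |G| >= p^2, then s is topologically         *)
(* nilpotent and Gamma is again local, with radical defined by the same       *)
(* condition on augmentations.                                                *)
(* A left ideal S x of a hereditary ring S is projective, hence the left      *)
(* annihilator of x is S (1 - e) for some e in S with e x = x.  For x the sum *)
(* of a normal subgroup H this forces e = x / |H|, so this idempotent lies in *)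
(* S.  For S = Gamma, H = G this gives |G| = p; for S = Delta and H of order  *)
(* p and index at least 3, the idempotent times g - 1 is not in Gamma.        *)
(* Conversely, if |G| = p, respectively |G| = 4, the unit element of the      *)
(* order is a sum of idempotents e of Q_p G contained in it, such that e cuts *)
(* out a discrete valuation ring, with uniformizer p or 1 - g.  An element x  *)
(* of an ideal I such that x e has minimal valuation provides a dual basis of *)
(* I e.                                                                       *)

(** Necessity rests on [hereditary_galg_sum]: a hereditary ring between Z_pG and Q_pG contains the
    averaging idempotent of every normal subgroup, while [gammaP] gives Gamma explicitly and so
    bounds the denominators that Gamma and Delta admit. The contradictions are drawn in
    [hereditary_gamma_card] and [hereditary_delta_card]. That Z_pG and Gamma are local comes from
    [Fp_galg_rreg]: an element of F_pG with nonzero augmentation is regular, hence invertible by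
    finiteness, and [galg_geometric] lifts inverses from residues modulo p. This identifies both
    radicals. Sufficiency rests on [hereditary_at_dvr], which produces a dual basis on one
    component, and on [hereditary_sum], which glues the components. For |G| = p these are Z_p and
    Z_p[zeta_p]; for |G| = 4 they are copies of Z_2 and, if G is cyclic, one copy of Z_2[i]. *)

Set Implicit Arguments.
Unset Strict Implicit.
Unset Printing Implicit Defensive.

Import GRing.Theory.
Local Open Scope ring_scope.

(** * Left ideals, radicals and hereditary rings *)

Lemma left_idealP (R : nzRingType) (P : {pred R}) :
    0 \in P -> (forall a u v, u \in P -> v \in P -> a * u + v \in P) ->
  exists I : left_ideal R, forall x, (x \in I) = (x \in P).
Proof.
move=> P0 PD.
have PS : @submod_closed R R^o P by split=> // a u v; apply: PD.
pose I : left_ideal R :=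
  HB.pack (P : R^o -> bool) (GRing.isSubmodClosed.Build R R^o P PS).
by exists I => x.
Qed.

Lemma linear_extP (R : nzRingType) (U V : lmodType R) (f : U -> V) :
  linear f -> exists g : {linear U -> V}, forall x, g x = f x.
Proof.
move=> fP; pose g : {linear U -> V} :=
  HB.pack f (GRing.isLinear.Build R U V *:%R f fP).
by exists g.
Qed.

Lemma left_idealMl (R : nzRingType) (I : left_ideal R) (a x : R) :
  x \in I -> a * x \in I.
Proof. exact: (@rpredZ R R^o I a x). Qed.

(** Every element outside the left ideal [P] is left invertible, so a proper left ideal lies inside
    [P], and [P] is the only maximal left ideal. *)
Lemma jacobson_local (R : nzRingType) (P : {pred R}) :
    0 \in P -> (forall a u v, u \in P -> v \in P -> a * u + v \in P) ->
    1 \notin P -> (forall x, x \notin P -> exists t, t * x = 1) ->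
  forall x, (x \in jacobson R) = (x \in P).
Proof.
move=> P0 PD P1 PU x.
have [I IP] := left_idealP P0 PD.
have sub_I (M : left_ideal R) : 1 \notin M -> {subset M <= I}.
  move=> M1 y My; rewrite IP; apply/negP => /negP/PU[t ty].
  by case/negP: M1; rewrite -ty left_idealMl.
have maxI : maximal_left_ideal I by split=> [|M _ /sub_I //]; rewrite IP.
apply/asboolP/idP => [/(_ I maxI)|Px M [M1 maxM]]; first by rewrite IP.
by apply: (maxM I); rewrite ?IP //; exact: sub_I.
Qed.

Lemma jacobson_of_local (A : nzRingType) (S : subringClosed A) (N : {pred A}) :
    0 \in N ->
    (forall a u v, a \in S -> u \in N -> v \in N -> a * u + v \in N) ->
    1 \notin N ->
    (forall x, x \in S -> x \notin N -> exists2 t, t \in S & t * x = 1) ->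
  forall x, (x \in jacobson_of S) = (x \in S) && (x \in N).
Proof.
move=> N0 ND N1 NU x.
pose P : {pred subring S} := fun y => \val y \in N.
have JP y : (y \in jacobson (subring S)) = (\val y \in N).
  apply: (@jacobson_local (subring S) P) => [||//|z Nz].
  - by rewrite unfold_in raddf0.
  - move=> a u v Pu Pv; rewrite unfold_in rmorphD rmorphM.
    by apply: ND => //; exact: subring_valP.
  - have [t St tz] := NU _ (subring_valP z) Nz.
    by exists (Subring St); apply: val_inj; rewrite rmorphM rmorph1.
apply/asboolP/andP => [[y Jy <-]|[Sx Nx]].
  by rewrite -JP Jy; split=> //; exact: subring_valP.
by exists (Subring Sx); rewrite ?JP.
Qed.

(** The surjection [a |-> a * x] onto the projective ideal [R x] has a linear section [h]. Take
    [e = h x]: then [b * e = h (b * x)] depends on [b * x] only. *)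
Lemma hereditary_principal (R : nzRingType) (x : R) : hereditary R ->
  exists2 e, e * x = x & forall b c, b * x = c * x -> b * e = c * e.
Proof.
move=> hR; pose P : {pred R} := fun y => `[< exists a, y = a * x >].
have [||I IP] := @left_idealP R P.
- by apply/asboolP; exists 0; rewrite mul0r.
- move=> a _ _ /asboolP[b ->] /asboolP[c ->]; apply/asboolP.
  by exists (a * b + c); rewrite mulrDl mulrA.
have Iax a : a * x \in I by rewrite IP; apply/asboolP; exists a.
pose f (a : R^o) : submodule I := Submodule (Iax a).
have f_lin : linear f.
  by move=> c a b; apply: val_inj; rewrite linearP /= mulrDl scalerAl.
have [fL fE] := linear_extP f_lin.
have fS y : exists a, fL a = y.
  have := submod_valP y; rewrite IP => /asboolP[a ya].
  by exists a; apply: val_inj; rewrite fE /= ya.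
have [h hK] := hR I _ _ fL idfun fS.
have Ix : x \in I by rewrite -[x]mul1r.
exists (h (Submodule Ix)) => [|b c bx].
  by have /(congr1 val) := hK (Submodule Ix); rewrite fE.
have hZ d : d * h (Submodule Ix) = h (Submodule (Iax d)).
  by rewrite -[LHS]/(d *: _) -linearZ; congr (h _); apply: val_inj.
by rewrite !hZ; congr (h _); apply: val_inj.
Qed.

Section DualBasis.
Variables (A : nzRingType) (S : subringClosed A).

(** The [x j] with the functionals [a |-> a * q j] form a dual basis. A lift of [g] sends [a] to the
    sum of the [(a * q j) *: m j], where [m j] is a preimage of [g (x j)]. *)
Lemma projective_dual_basis (I : left_ideal (subring S)) (J : finType)
    (x : J -> subring S) (q : J -> A) :
    (forall j, x j \in I) ->
    (forall j a, a \in I -> \val a * q j \in S) ->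
    (forall a, a \in I -> \sum_j \val a * q j * \val (x j) = \val a) ->
  projective (submodule I : lmodType (subring S)).
Proof.
move=> Ix Sq sum_q M N f g fS.
pose X j := Submodule (Ix j).
have /fin_all_exists[m fm] j : exists m, f m = g (X j) by exact: fS.
pose c j (a : submodule I) := Subring (Sq j _ (submod_valP a)).
pose h (a : submodule I) := \sum_j c j a *: m j.
have h_lin : linear h.
  move=> k a b; rewrite scaler_sumr -big_split; apply: eq_bigr => j _ /=.
  rewrite scalerA -scalerDl; congr (_ *: _); apply: val_inj.
  by rewrite rmorphD rmorphM /= mulrA -mulrDl.
have [hL hE] := linear_extP h_lin.
exists hL => a; rewrite hE linear_sum.
under eq_bigr do rewrite linearZ fm -linearZ.
rewrite -linear_sum; congr (g _); apply: val_inj.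
rewrite raddf_sum; apply: val_inj; rewrite raddf_sum /=.
by rewrite -[RHS](sum_q _ (submod_valP a)).
Qed.

(* The condition says that the ideal I e of S e is zero or invertible. *)
Definition hereditary_at (e : A) : Prop :=
  forall I : left_ideal (subring S), exists2 x, x \in I & exists q : A,
    forall a, a \in I ->
      \val a * q \in S /\ \val a * q * \val x = \val a * e.

(** As [a] is the sum of the [a * e j], the pairs [(x, q)] of the components together form a dual
    basis of [I]. *)
Lemma hereditary_sum (J : finType) (e : J -> A) :
    \sum_j e j = 1 -> (forall j, hereditary_at (e j)) ->
  hereditary (subring S).
Proof.
move=> sum_e he I.
have /fin_all_exists[x xP] j : exists x, x \in I /\ exists q : A,
    forall a, a \in I -> \val a * q \in S /\ \val a * q * \val x = \val a * e j.
  by have [x Ix xq] := he j I; exists x.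
have /fin_all_exists[q qP] j := (xP j).2.
apply: (@projective_dual_basis I J x q) => [j|j a Ia|a Ia].
- exact: (xP j).1.
- exact: (qP j a Ia).1.
- by rewrite (eq_bigr _ (fun j _ => (qP j a Ia).2)) -mulr_sumr sum_e mulr1.
Qed.

End DualBasis.

Lemma idealizerP (B : nzRingType) (N : zmodClosed B) (a : B) :
  reflect (forall x, x \in N -> a * x \in N /\ x * a \in N) (a \in idealizer N).
Proof. exact: asboolP. Qed.

(** * The p-adic numbers *)

(* O is a complete discrete valuation ring with uniformizer p and residue     *)
(* field F_p.                                                                 *)
Record padic_like (K : fieldType) (O : subringClosed K) (p : nat) : Prop := {
  padic_like_prime : prime p;
  padic_like_p_neq0 : p%:R != 0 :> K;
  padic_like_invp : p%:R^-1 \notin O;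
  padic_like_residue :
    forall x, x \in O -> exists k : nat, (x - k%:R) / p%:R \in O;
  padic_like_complete : forall u : nat -> K, (forall n, u n \in O) ->
    exists2 l, l \in O &
      forall n, (l - \sum_(i < n) p%:R ^+ i * u i) / p%:R ^+ n \in O;
  padic_like_separated : forall x, (forall n, x / p%:R ^+ n \in O) -> x = 0
}.

Section Padic.
Variables (p : nat) (p_pr : prime p).
Local Notation Z_p := (padic_int p_pr).
Implicit Types x y z : Z_p.

Lemma padic_sub_comp x y n : x n = y n -> (x - y) n = 0%N.
Proof.
move=> xy; rewrite /= xy modnDmr addnC subnK ?modnn //.
exact/ltnW/padic_ltn.
Qed.

Lemma padic_natE k n : (k%:R : Z_p) n = (k %% p ^ n)%N.
Proof.
elim: k => [|k IHk]; first by rewrite mod0n /= mod0n.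
by rewrite -addn1 natrD /= IHk modnDmr modnDml.
Qed.

Lemma padic_expn_comp n y : ((p%:R ^+ n : Z_p) * y) n = 0%N.
Proof. by rewrite -natrX /= padic_natE modnn mul0n mod0n. Qed.

(** Dividing by p^n costs n digits, so the m-th residue of the quotient is read off from the residue
    of [x] at index [m + n]. *)
Lemma padic_divp_expn x n : x n = 0%N -> exists y, x = p%:R ^+ n * y.
Proof.
move=> xn0; have p_gt0 m : (0 < p ^ m)%N by exact: padic_pn.
have dvx m : (p ^ n %| x (m + n))%N by rewrite /dvdn addnC padic_modD xn0.
have yP m : (x (m.+1 + n) %/ p ^ n = x (m + n) %/ p ^ n %[mod p ^ m])%N.
  rewrite addSn (divn_eq (x (m + n).+1) (p ^ (m + n))) -padic_seqP.
  by rewrite expnD mulnA divnMDl // modnMDl.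
exists (padic_of p_pr yP); apply: padicP => m.
rewrite -natrX /= padic_natE modnMml modnMmr mulnC divnK //.
by rewrite padic_modD.
Qed.

(** The limit takes its n-th residue from the n-th partial sum, because later terms are divisible by
    p^n. *)
Lemma padic_complete (u : nat -> Z_p) :
  exists l : Z_p, forall n, exists y,
    l - \sum_(i < n) p%:R ^+ i * u i = p%:R ^+ n * y.
Proof.
pose s n := \sum_(i < n) p%:R ^+ i * u i.
have sS n : s n.+1 n = s n n.
  by rewrite /s big_ord_recr /= -natrX padic_natE modnn mul0n mod0n addn0
    padic_mod.
have lP n : (s n.+1 n.+1 = s n n %[mod p ^ n])%N.
  by rewrite padic_modS sS.
exists (padic_of p_pr lP) => n.
apply: padic_divp_expn; apply: padic_sub_comp.
by rewrite /= padic_mod.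
Qed.

Lemma padic_natr_neq0 k : (0 < k)%N -> k%:R != 0 :> Z_p.
Proof.
move=> k_gt0; apply/eqP => /(congr1 (fun x : Z_p => x k)).
rewrite padic_natE /= mod0n modn_small ?(ltn_expl, prime_gt1) // => k0.
by rewrite k0 in k_gt0.
Qed.

(** The group algebra arguments below use Z_p only through these properties. *)
Lemma padic_int_like : padic_like (@padic_integral_elt p p_pr) p.
Proof.
pose K : fieldType := padic p_pr.
have tfP (x : Z_p) : (FracField.tofrac x : K) \in @padic_integral_elt p p_pr.
  by apply/asboolP; exists x.
have pK0 : (p%:R : K) != 0.
  rewrite -(rmorph_nat (@FracField.tofrac Z_p)) tofrac_eq0 padic_natr_neq0 //.
  exact: prime_gt0.
have divP (x : Z_p) n y : x = p%:R ^+ n * y ->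
    (FracField.tofrac x : K) / p%:R ^+ n = FracField.tofrac y.
  move=> ->; rewrite rmorphM rmorphXn rmorph_nat mulrAC divff ?mul1r //.
  exact: expf_neq0.
split=> //.
- apply/asboolP => -[z pz].
  have : (p%:R : Z_p) * z = 1.
    by apply/eqP; rewrite -tofrac_eq tofracM -pz tofrac1 rmorph_nat mulfV ?eqxx.
  move=> /(congr1 (fun x : Z_p => x 1%N)); rewrite -[p%:R]expr1.
  by rewrite padic_expn_comp /= expn1 modn_small ?prime_gt1.
- move=> _ /asboolP[x ->]; exists (x 1%N).
  have [|y xy] := @padic_divp_expn (x - (x 1%N)%:R) 1.
    by apply: padic_sub_comp; rewrite padic_natE padic_mod.
  by rewrite -(rmorph_nat (@FracField.tofrac Z_p)) -rmorphB -[p%:R]expr1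
    (divP _ _ _ xy).
- move=> u uO; have uP n : exists v : Z_p, u n = FracField.tofrac v.
    exact/asboolP/uO.
  have [v uv] := boolp.choice uP.
  have [l lP] := padic_complete v.
  exists (FracField.tofrac l) => // n; have [y ly] := lP n.
  have -> : \sum_(i < n) p%:R ^+ i * u i =
      FracField.tofrac (\sum_(i < n) p%:R ^+ i * v i) :> K.
    rewrite rmorph_sum; apply: eq_bigr => i _.
    by rewrite rmorphM rmorphXn rmorph_nat uv.
  by rewrite -rmorphB (divP _ _ _ ly).
- move=> x xP.
  have /asboolP[z] := xP 0%N; rewrite divr1 => xz.
  suff z0 : z = 0 by rewrite xz z0 rmorph0.
  apply: padicP => n; rewrite [RHS]mod0n.
  have /asboolP[y] := xP n.
  rewrite xz => /(canRL (mulfVK (expf_neq0 n pK0))).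
  rewrite -(rmorph_nat (@FracField.tofrac Z_p)) -rmorphXn -rmorphM => /eqP.
  by rewrite tofrac_eq => /eqP ->; rewrite mulrC padic_expn_comp.
Qed.
End Padic.

(** * The residue map to F_p *)

Section PadicLike.
Variables (K : fieldType) (O : subringClosed K) (p : nat).
Hypothesis KO : padic_like O p.
Implicit Types x y : K.

Let p_pr : prime p := padic_like_prime KO.
Let p0 : p%:R != 0 :> K := padic_like_p_neq0 KO.

(** If p does not divide k, a Bezout relation between k and p turns [k / p] in [O] into [1 / p] in
    [O], which is excluded. *)
Lemma natr_divp k : (k%:R / p%:R \in O) = (p %| k)%N.
Proof.
apply/idP/dvdnP => [Ok|[m ->]]; last by rewrite natrM mulfK ?rpred_nat.
apply/dvdnP; apply: contraT; rewrite -prime_coprime // => cpk.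
have k_gt0 : (0 < k)%N.
  by rewrite lt0n; apply: contraTneq cpk => ->; rewrite prime_coprime ?dvdn0.
have [u v uk _] := egcdnP p k_gt0.
case/negP: (padic_like_invp KO).
have -> : p%:R^-1 = u%:R * (k%:R / p%:R) - v%:R :> K.
  rewrite mulrA -natrM uk gcdnC (eqP cpk) natrD natrM mulrDl mulfK // mul1r.
  by rewrite addrAC subrr add0r.
by apply: rpredB; rewrite ?rpred_nat //; apply: rpredM; rewrite ?rpred_nat.
Qed.

(** Made total on [K]: outside [O] no such [k] exists and the value is 0. On [O] the value is
    independent of the chosen [k] by [residue_eq]. *)
Definition residue x : 'F_p :=
  if pselect (exists k : nat, (x - k%:R) / p%:R \in O) is left ex
  then (sval (cid ex))%:R else 0.

Lemma residue_eq x k : (x - k%:R) / p%:R \in O -> residue x = k%:R.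
Proof.
move=> xk; rewrite /residue; case: pselect => [ex|[]]; last by exists k.
case: cid => l /= xl; have : (l%:R - k%:R) / p%:R \in O.
  have -> : l%:R - k%:R = (x - k%:R) - (x - l%:R).
    by rewrite opprB [RHS]addrC subrKA.
  by rewrite mulrBl rpredB.
wlog le_kl : k l {xk xl} / (k <= l)%N => [IH kl|].
  have [/IH|/ltnW /IH IHlk] := leqP k l; first exact.
  by apply/esym/IHlk; rewrite -opprB mulNr rpredN.
rewrite -natrB // natr_divp => /dvdnP[m mE].
rewrite -(subnK le_kl) mE natrD natrM pchar_Fp_0 //.
by rewrite mulr0 add0r.
Qed.

Lemma residue_nat k : residue k%:R = k%:R.
Proof. by apply: residue_eq; rewrite subrr mul0r rpred0. Qed.

Lemma residueD x y : x \in O -> y \in O ->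
  residue (x + y) = residue x + residue y.
Proof.
move=> /(padic_like_residue KO)[k xk] /(padic_like_residue KO)[l yl].
rewrite (residue_eq xk) (residue_eq yl) -natrD; apply: residue_eq.
by rewrite natrD opprD addrACA mulrDl rpredD.
Qed.

Lemma residueB x y : x \in O -> y \in O ->
  residue (x - y) = residue x - residue y.
Proof.
move=> Ox Oy; apply: (addIr (residue y)); rewrite -residueD ?rpredB //.
by rewrite !subrK.
Qed.

Lemma residueM x y : x \in O -> y \in O ->
  residue (x * y) = residue x * residue y.
Proof.
move=> /(padic_like_residue KO)[k xk] Oy.
have [l yl] := padic_like_residue KO Oy.
rewrite (residue_eq xk) (residue_eq yl) -natrM; apply: residue_eq.
have -> : x * y - (k * l)%:R = (x - k%:R) * y + k%:R * (y - l%:R).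
  by rewrite mulrBl mulrBr natrM subrKA.
by rewrite mulrDl mulrAC -(mulrA k%:R) rpredD // rpredM ?rpred_nat.
Qed.

Lemma residue_sum (I : Type) (r : seq I) (P : pred I) (F : I -> K) :
  (forall i, P i -> F i \in O) ->
  residue (\sum_(i <- r | P i) F i) = \sum_(i <- r | P i) residue (F i).
Proof.
move=> OF; suff [] : \sum_(i <- r | P i) F i \in O /\
    residue (\sum_(i <- r | P i) F i) = \sum_(i <- r | P i) residue (F i) by [].
apply: (big_ind2 (fun x (z : 'F_p) => x \in O /\ residue x = z)) =>
  [|x z y t|i Pi].
- by rewrite rpred0 (residue_nat 0).
- by case=> Ox <- [Oy <-]; rewrite residueD ?rpredD.
- by split=> //; exact: OF.
Qed.

Lemma residue_eq0 x : x \in O -> (residue x == 0) = (x / p%:R \in O).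
Proof.
move=> Ox; apply/eqP/idP => [|xp]; last first.
  by rewrite (@residue_eq _ 0) // subr0.
have [k xk] := padic_like_residue KO Ox; rewrite (residue_eq xk) => k0.
have : (p %| k)%N by rewrite (dvdn_pcharf (pchar_Fp p_pr)) k0.
rewrite -natr_divp => kp.
by rewrite -(subrK k%:R x) mulrDl rpredD.
Qed.

End PadicLike.

(** * Group algebras *)

Section Augmentation.
Variables (R : comNzRingType) (gT : finGroupType).
Local Notation RG := (group_algebra R gT).
Implicit Types (a b : RG) (g h : gT).

Definition galg_aug a : R := \sum_g a g.

Definition galg_elt g : RG := [ffun h => (h == g)%:R].

Definition galg_sum (H : {set gT}) : RG := [ffun h => (h \in H)%:R].

Lemma galg_mulE a b g : (a * b) g = \sum_h a h * b (h^-1 * g)%g.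
Proof. by rewrite ffunE. Qed.

Lemma galg_aug_is_zmod_morphism : zmod_morphism galg_aug.
Proof.
by move=> a b; rewrite -sumrB; apply: eq_bigr => g _; rewrite !ffunE.
Qed.
HB.instance Definition _ :=
  GRing.isZmodMorphism.Build RG R galg_aug galg_aug_is_zmod_morphism.

Lemma galg_aug_is_monoid_morphism : monoid_morphism galg_aug.
Proof.
split=> [|a b].
  rewrite /galg_aug (bigD1 1%g) //= ffunE eqxx big1 ?addr0 // => g /negPf g1.
  by rewrite ffunE g1.
rewrite /galg_aug; under eq_bigr do rewrite galg_mulE.
rewrite exchange_big mulr_suml; apply: eq_bigr => h _ /=.
rewrite mulr_sumr (reindex_inj (mulgI h)) /=.
by apply: eq_bigr => g _; rewrite mulKg.
Qed.
HB.instance Definition _ :=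
  GRing.isMonoidMorphism.Build RG R galg_aug galg_aug_is_monoid_morphism.

Lemma galg_augZ k a : galg_aug (k *: a) = k * galg_aug a.
Proof. by rewrite mulr_sumr; apply: eq_bigr => g _; rewrite ffunE. Qed.

Lemma galg_aug_elt g : galg_aug (galg_elt g) = 1.
Proof.
rewrite /galg_aug (bigD1 g) //= ffunE eqxx big1 ?addr0 // => h /negPf hg.
by rewrite ffunE hg.
Qed.

Lemma galg_aug_sum (H : {set gT}) : galg_aug (galg_sum H) = #|H|%:R.
Proof.
rewrite /galg_aug -sum1_card natr_sum [RHS]big_mkcond.
by apply: eq_bigr => g _; rewrite ffunE; case: (g \in H).
Qed.

Lemma galg_elt_mulE g a h : (galg_elt g * a) h = a (g^-1 * h)%g.
Proof.
rewrite galg_mulE (bigD1 g) //= ffunE eqxx mul1r big1 ?addr0 // => k /negPf kg.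
by rewrite ffunE kg mul0r.
Qed.

Lemma galg_mul_eltE g a h : (a * galg_elt g) h = a (h * g^-1)%g.
Proof.
rewrite galg_mulE (bigD1 (h * g^-1)%g) //= ffunE invMg invgK mulgKV eqxx mulr1.
rewrite big1 ?addr0 // => k kg; rewrite ffunE (_ : _ == _ = false) ?mulr0 //.
apply: contraNF kg => /eqP <-; apply/eqP.
by rewrite invMg invgK mulKVg.
Qed.

Lemma galg_elt1 : galg_elt 1 = 1.
Proof. by []. Qed.

Lemma galg_eltM : {morph galg_elt : g h / (g * h)%g >-> g * h}.
Proof.
move=> g h; apply/ffunP => k; rewrite galg_elt_mulE !ffunE.
by rewrite (can2_eq (mulKVg g) (mulKg g)).
Qed.

Lemma galg_eltX g n : galg_elt (g ^+ n) = galg_elt g ^+ n.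
Proof.
by elim: n => [|n IHn]; rewrite ?expg0 // expgS exprS galg_eltM IHn.
Qed.

Lemma galg_basis a : a = \sum_g a g *: galg_elt g.
Proof.
apply/ffunP => h; rewrite sum_ffunE (bigD1 h) //= !ffunE eqxx.
rewrite [_ *: _]mulr1 big1 ?addr0 // => g /negPf gh.
by rewrite !ffunE eq_sym gh; apply: mulr0.
Qed.

Lemma galg_sumE (H : {set gT}) : galg_sum H = \sum_(g in H) galg_elt g.
Proof.
apply/ffunP => h; rewrite sum_ffunE ffunE; case: (boolP (h \in H)) => hH.
  rewrite (bigD1 h) //= ffunE eqxx big1 ?addr0 // => g /andP[_ /negPf gh].
  by rewrite ffunE eq_sym gh.
rewrite big1 // => g gH; rewrite ffunE.
by case: eqP => // hg; rewrite hg gH in hH.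
Qed.

Lemma galg_sumT_mull a : galg_sum [set: gT] * a = galg_aug a *: galg_sum setT.
Proof.
apply/ffunP => h; rewrite galg_mulE !ffunE inE [RHS]mulr1.
rewrite /galg_aug (reindex_inj (@invg_inj gT)) (reindex_inj (mulIg h^-1)%g) /=.
by apply: eq_bigr => g _; rewrite ffunE inE mul1r invgK mulgKV.
Qed.

Lemma galg_sumT_mulr a : a * galg_sum [set: gT] = galg_aug a *: galg_sum setT.
Proof.
apply/ffunP => h; rewrite galg_mulE !ffunE inE [RHS]mulr1.
by apply: eq_bigr => g _; rewrite ffunE inE mulr1.
Qed.

Lemma galg_mulC a b : abelian [set: gT] -> a * b = b * a.
Proof.
move=> /centsP cG; apply/ffunP => h; rewrite !galg_mulE.
rewrite (reindex_inj (@invg_inj gT)) (reindex_inj (mulIg h^-1)%g) /=.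
apply: eq_bigr => g _; rewrite mulrC invgK mulgKV; congr (_ * a _).
by rewrite invMg invgK; apply: cG; rewrite inE.
Qed.

End Augmentation.

Arguments galg_elt R {gT} g.
Arguments galg_sum R {gT} H.

Lemma card_zmod_closed_dvdn (U : finZmodType) (V : {set U}) :
  0 \in V -> {in V &, forall x y, x + y \in V} -> (#|V| %| #|U|)%N.
Proof.
move=> V0 VD.
have Vg : group_set V by apply/group_setP; split.
by rewrite -cardsT (cardSg (subsetT (Group Vg))).
Qed.

(* A nonzero left ideal of F_p G contains a nonzero G-invariant element, that *)
(* is, a nonzero multiple of the sum of all group elements.                   *)
Lemma Fp_galg_rreg (p : nat) (gT : finGroupType) (a v : group_algebra 'F_p gT) :
    prime p -> (p.-group [set: gT])%g -> galg_aug a != 0 -> v * a = 0 -> v = 0.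
Proof.
move=> p_pr pG a0 va.
pose T : finZmodType := HB.pack_for finZmodType
  (group_algebra 'F_p gT) (Finite.on {ffun gT -> 'F_p}).
(* Actions are right actions here, so [g] acts by left multiplication with its inverse. *)
pose to_fun (w : T) (g : gT) : T :=
  galg_elt 'F_p g^-1 * (w : group_algebra _ _).
have to1 : to_fun^~ 1%g =1 id.
  by move=> w; rewrite /to_fun invg1 galg_elt1 mul1r.
have toM w : act_morph to_fun w.
  by move=> g h; rewrite /to_fun invMg galg_eltM mulrA.
pose to := TotalAction to1 toM.
pose V : {set T} := [set w : T | (w : group_algebra _ _) * a == 0].
have V0 : 0 \in V by rewrite inE mul0r.
have VD : {in V &, forall x y, x + y \in V}.
  by move=> x y; rewrite !inE mulrDl => /eqP -> /eqP ->; rewrite addr0.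
have dvdV := card_zmod_closed_dvdn V0 VD.
have Vpnat : p.-nat #|V|.
  apply: pnat_dvd dvdV _.
  by rewrite [#|_|](_ : _ = (p ^ #|gT|)%N) ?pnatX ?pnat_id // card_ffun card_Fp.
have actsV : [acts [set: gT], on V | to].
  apply/actsP => g _ w; rewrite !inE /= /to_fun -mulrA.
  apply/eqP/eqP => [/(congr1 (fun x => galg_elt 'F_p g * x))|->];
    last exact: mulr0.
  by rewrite mulr0 mulrA -galg_eltM mulgV galg_elt1 mul1r.
(* A fixed [w] is constant on the group, hence a multiple of the norm element, so [w * a] is
   [galg_aug a *: w]; since [galg_aug a] is nonzero, [w] vanishes. *)
have Fix0 : 'Fix_(V | to)([set: gT])%g = [set (0 : T)].
  apply/setP => w; rewrite in_setI in_set1.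
  apply/andP/eqP => [[Vw /afixP wG]|->]; last first.
    by split=> //; apply/afixP => g _; rewrite /= /to_fun mulr0.
  have wE : w = (w : group_algebra _ _) 1%g *: galg_sum 'F_p setT.
    apply/ffunP => h.
    have /(congr1 (fun u : group_algebra _ _ => u 1%g)) := wG h (in_setT _).
    rewrite /= /to_fun galg_elt_mulE invgK mulg1 !ffunE inE => ->.
    by rewrite [RHS]mulr1.
  move: Vw; rewrite inE {1}wE -scalerAl galg_sumT_mull scalerA => /eqP.
  move=> /(congr1 (fun u : group_algebra _ _ => u 1%g)); rewrite !ffunE inE.
  move=> /eqP; rewrite [_ *: _]mulr1 mulf_eq0 (negPf a0) orbF => /eqP w1.
  by rewrite wE w1 scale0r.
(* The order of the annihilator [V] is a power of p congruent to 1 modulo p, hence 1. *)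
have := pgroup_fix_mod pG actsV; rewrite Fix0 cards1.
have [k cardV] := p_natP Vpnat; rewrite cardV.
case: k cardV => [|k] cardV; last first.
  by rewrite expnS modnMr modn_small ?prime_gt1.
have /card_le1_eqP V1 : (#|V| <= 1)%N by rewrite cardV.
have Vv : (v : T) \in V by rewrite inE va.
by move=> _; rewrite (V1 _ _ Vv V0).
Qed.

(** * The orders Gamma and Delta *)

Section IntegralGroupAlgebra.
Variables (K : fieldType) (O : subringClosed K) (p : nat) (gT : finGroupType).
Local Notation A := (group_algebra K gT).
Variable L : subringClosed A.
Hypothesis KO : padic_like O p.
Hypothesis pG : (p.-group [set: gT])%g.
Hypothesis LE : forall a, (a \in L) = [forall g, a g \in O].
Implicit Types (a b x : A) (r : K).

Let p_pr : prime p := padic_like_prime KO.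
Let p0 : p%:R != 0 :> K := padic_like_p_neq0 KO.

Lemma galg_intP a : reflect (forall g, a g \in O) (a \in L).
Proof. by rewrite LE; exact: forallP. Qed.

Lemma galg_elt_int g : galg_elt K g \in L.
Proof. by apply/galg_intP => h; rewrite ffunE rpred_nat. Qed.

Lemma galg_sum_int H : galg_sum K H \in L.
Proof. by apply/galg_intP => h; rewrite ffunE rpred_nat. Qed.

Lemma galg_int_scale r a : r \in O -> a \in L -> r *: a \in L.
Proof.
by move=> Or /galg_intP aO; apply/galg_intP => g; rewrite ffunE; exact: rpredM.
Qed.

Lemma galg_aug_int a : a \in L -> galg_aug a \in O.
Proof. by move=> /galg_intP aO; exact: rpred_sum. Qed.

(** * Reduction modulo p and inverses in the integral group ring *)

Definition reduce a : group_algebra 'F_p gT := [ffun g => residue O p (a g)].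

Lemma reduceM : {in L &, forall a b, reduce (a * b) = reduce a * reduce b}.
Proof.
move=> a b /galg_intP aO /galg_intP bO; apply/ffunP => g; rewrite !ffunE.
rewrite (residue_sum KO) => [|h _]; last exact: rpredM.
by apply: eq_bigr => h _; rewrite (residueM KO) // !ffunE.
Qed.

Lemma reduce1 : reduce 1 = 1.
Proof. by apply/ffunP => g; rewrite !ffunE (residue_nat KO). Qed.

Lemma reduceX n : {in L, forall a, reduce (a ^+ n) = reduce a ^+ n}.
Proof.
move=> a La; elim: n => [|n IHn]; first exact: reduce1.
by rewrite !exprS reduceM ?rpredX // IHn.
Qed.

Lemma galg_aug_reduce a :
  a \in L -> galg_aug (reduce a) = residue O p (galg_aug a).
Proof.
move=> /galg_intP aO; rewrite /galg_aug (residue_sum KO) //.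
by apply: eq_bigr => g _; rewrite ffunE.
Qed.

Lemma reduce_eq a b : a \in L -> b \in L -> reduce a = reduce b ->
  p%:R^-1 *: (a - b) \in L.
Proof.
move=> /galg_intP aO /galg_intP bO /ffunP ab; apply/galg_intP => g.
rewrite !ffunE [_ *: _]mulrC -(residue_eq0 KO) ?rpredB // (residueB KO) //.
by have := ab g; rewrite !ffunE => ->; rewrite subrr.
Qed.

Lemma reduce_surj (b : group_algebra 'F_p gT) :
  exists2 a, a \in L & reduce a = b.
Proof.
exists [ffun g => (nat_of_ord (b g))%:R].
  by apply/galg_intP => g; rewrite ffunE rpred_nat.
apply/ffunP => g; rewrite !ffunE (residue_nat KO).
exact: natr_Zp.
Qed.

(** Right multiplication by the reduction of [a] is injective on the finite ring F_pG, hence reaches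
    1; lift the preimage. *)
Lemma galg_linv_mod a : a \in L -> galg_aug a / p%:R \notin O ->
  exists2 t, t \in L & p%:R^-1 *: (t * a - 1) \in L.
Proof.
move=> La aN; have augN : galg_aug (reduce a) != 0.
  by rewrite galg_aug_reduce // (residue_eq0 KO) ?galg_aug_int.
pose f (v : group_algebra 'F_p gT) := v * reduce a.
have f_inj : injective f.
  move=> v w /eqP; rewrite -subr_eq0 -mulrBl => /eqP vw.
  by apply/eqP; rewrite -subr_eq0 (Fp_galg_rreg p_pr pG augN vw).
have [g _ fg] := @injF_bij {ffun gT -> 'F_p} _ f_inj.
have [t Lt tE] := reduce_surj (g (1 : group_algebra 'F_p gT)).
exists t => //; apply: reduce_eq; rewrite ?rpredM ?rpred1 //.
by rewrite reduceM // tE reduce1; exact: fg.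
Qed.

(** In the finite ring F_pG two powers of the reduction [r] of [a] agree, so
    [r ^+ i * (1 - r ^+ (j - i)) = 0] with [i < j]. The second factor has augmentation 1 and is
    regular, so [r ^+ i = 0]. *)
Lemma galg_int_nilpotent a : a \in L -> galg_aug a / p%:R \in O ->
  exists m, p%:R^-1 *: a ^+ m \in L.
Proof.
move=> La aP; have aug0 : galg_aug (reduce a) = 0.
  by apply/eqP; rewrite galg_aug_reduce // (residue_eq0 KO) ?galg_aug_int.
pose f (i : 'I_(#|{ffun gT -> 'F_p}|.+1)) : {ffun gT -> 'F_p} := reduce a ^+ i.
have [i [j [ltij eqij]]] : exists i j : nat,
    (i < j)%N /\ reduce a ^+ i = reduce a ^+ j.
  have /injectivePn[i [j ij fij]] : ~~ injectiveb f.
    apply/injectiveP => /leq_card; rewrite card_ord.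
    by rewrite ltnn.
  move: ij; rewrite neq_ltn => /orP[ij|ji]; first by exists i, j.
  by exists j, i.
exists i; rewrite -[a ^+ i]subr0; apply: reduce_eq; rewrite ?rpredX ?rpred0 //.
rewrite reduceX // [RHS](_ : _ = 0); last first.
  by apply/ffunP => g; rewrite !ffunE (residue_nat KO 0).
apply: (@Fp_galg_rreg p gT (1 - reduce a ^+ (j - i))) => //.
  rewrite rmorphB rmorph1 rmorphXn /= aug0 expr0n subn_eq0 leqNgt ltij.
  by rewrite subr0 oner_neq0.
by rewrite mulrBr mulr1 -exprD subnKC ?(ltnW ltij) // eqij subrr.
Qed.

(* The inverse of 1 - p w is a geometric series; its convergence is checked   *)
(* coefficientwise, after clearing the denominators of S by p ^ c.            *)
Lemma galg_geometric (S : subringClosed A) (c : nat) (w : A) :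
    {subset L <= S} -> (forall a, a \in S -> p%:R ^+ c *: a \in L) -> w \in S ->
  exists2 t, t \in S & t * (1 - p%:R *: w) = 1.
Proof.
move=> LS SL Sw; set P := p%:R : K.
have P0 n : P ^+ n != 0 by exact: expf_neq0.
have Su i : P ^+ c *: w ^+ i \in L by apply: SL; exact: rpredX.
have /fin_all_exists[l lP] g : exists l, l \in O /\ forall n,
    (l - \sum_(i < n) P ^+ i * (P ^+ c *: w ^+ i) g) / P ^+ n \in O.
  have [|l Ol lP] := @padic_like_complete _ _ _ KO
    (fun i => (P ^+ c *: w ^+ i) g).
    by move=> i; exact: galg_intP (Su i) g.
  by exists l.
pose l0 : A := [ffun g => l g].
pose s n := \sum_(i < n) (P *: w) ^+ i.
have sP n : P ^- n *: (l0 - P ^+ c *: s n) \in L.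
  apply/galg_intP => g; have := (lP g).2 n; congr (_ \in O).
  rewrite !ffunE [RHS]mulrC; congr ((_ - _) / _).
  rewrite sum_ffunE [RHS]mulr_sumr; apply: eq_bigr => i _.
  by rewrite exprZn !ffunE; exact: mulrCA.
pose t := P ^- c *: l0.
have tP n : P ^+ c *: (t - s n) = l0 - P ^+ c *: s n.
  by rewrite scalerBr scalerA mulfV // scale1r.
have sE n : s n * (1 - P *: w) = 1 - (P *: w) ^+ n.
  elim: n => [|n IHn]; first by rewrite /s big_ord0 mul0r subrr.
  rewrite /s big_ord_recr /= mulrDl IHn mulrBr mulr1 -exprSr.
  by rewrite addrA subrK.
exists t.
  have := sP c; rewrite -tP scalerA mulVf // scale1r => /LS St.
  rewrite -(subrK (s c) t) rpredD // rpred_sum // => i _.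
  by rewrite rpredX // scaler_nat rpredMn.
apply/eqP; rewrite -subr_eq0; apply/eqP/ffunP => g; rewrite [RHS]ffunE.
(* One factor [P ^+ c] clears the denominators of [t - s n], the other those of [1 - P *: w]. *)
have: P ^+ (c + c) * (t * (1 - P *: w) - 1) g = 0.
  apply: (padic_like_separated KO) => n; rewrite -/P.
  have -> : P ^+ (c + c) * (t * (1 - P *: w) - 1) g / P ^+ n =
      (P ^- n *: (P ^+ c *: (P ^+ c *: (t * (1 - P *: w) - 1)))) g.
    by rewrite !ffunE mulrC exprD -mulrA.
  apply/galg_intP.
  have -> : t * (1 - P *: w) - 1 = (t - s n) * (1 - P *: w) - P ^+ n *: w ^+ n.
    by rewrite mulrBl sE exprZn opprB addrA addrAC addrK.
  have scaleE u v q : P ^- n *: (P ^+ c *: (P ^+ c *: (u * v - P ^+ n *: q))) =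
      P ^- n *: (P ^+ c *: u) * (P ^+ c *: v) - P ^+ c *: (P ^+ c *: q) :> A.
    rewrite !scalerBr -!scalerAl -scalerAr; congr (_ - _).
    rewrite !scalerA; congr (_ *: _).
    by rewrite mulrC mulrA mulfV // mul1r.
  rewrite scaleE.
  have Lw : P ^+ c *: (1 - P *: w) \in L.
    by rewrite SL // rpredB ?rpred1 // scaler_nat rpredMn.
  have Lu : P ^+ c *: (P ^+ c *: w ^+ n) \in L.
    by rewrite galg_int_scale // -natrX rpred_nat.
  by rewrite rpredB // rpredM // tP.
by move/eqP; rewrite mulf_eq0 (negPf (P0 _)) => /eqP.
Qed.

(** A left inverse [t] modulo p gives [t * a] in [1 + p L], which a geometric series inverts. *)
Lemma galg_int_linv a : a \in L -> galg_aug a / p%:R \notin O ->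
  exists2 t, t \in L & t * a = 1.
Proof.
move=> La aN; have [t Lt Lw] := galg_linv_mod La aN.
have [|u Lu uE] := @galg_geometric L 0 _ (fun _ => id) _ (rpredNr Lw).
  by move=> b Lb; rewrite scale1r.
exists (u * t); first exact: rpredM.
rewrite -mulrA -[RHS]uE; congr (_ * _).
by rewrite scalerN opprK scalerA mulfV // scale1r addrC subrK.
Qed.

(** Serves both [L] and Gamma: each is local with the same condition on augmentations. *)
Lemma jacobson_of_aug (S : subringClosed A) a :
    (forall a, a \in S -> galg_aug a \in O) ->
    (forall a, a \in S -> galg_aug a / p%:R \notin O ->
       exists2 t, t \in S & t * a = 1) ->
  (a \in jacobson_of S) = (a \in S) && (galg_aug a / p%:R \in O).
Proof.
move=> SO SU.
apply: (@jacobson_of_local A S [pred a | galg_aug a / p%:R \in O]) =>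
  [|b u v Sb||b Sb].
- by rewrite inE raddf0 mul0r rpred0.
- rewrite !inE => uP vP; rewrite rmorphD rmorphM mulrDl -mulrA.
  by rewrite rpredD // rpredM // SO.
- by rewrite inE rmorph1 mul1r (padic_like_invp KO).
- by rewrite inE; exact: SU.
Qed.

Lemma jacobson_int a :
  (a \in jacobson_of L) = (a \in L) && (galg_aug a / p%:R \in O).
Proof.
by apply: jacobson_of_aug => [b|b Lb];
  [exact: galg_aug_int | exact: galg_int_linv].
Qed.

Lemma galg_sum_central (H : {group gT}) a :
  (H <| [set: gT])%g -> a * galg_sum K H = galg_sum K H * a.
Proof.
move=> /andP[_ nH]; rewrite [a]galg_basis mulr_suml mulr_sumr.
apply: eq_bigr => g _; rewrite -scalerAl -scalerAr; congr (_ *: _).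
apply/ffunP => h; rewrite galg_elt_mulE galg_mul_eltE !ffunE.
by rewrite -(memJ_norm (h * g^-1)%g (subsetP nH g (in_setT g))) conjgE mulgKV.
Qed.

(** Let [x] be the sum of [H] and [e] as in [hereditary_principal]. For h in [H], [h x = x] gives
    [h e = e], so [x e] is [#|H|] times [e]; by normality [x] is central, so [x e = e x = x]. *)
Lemma hereditary_galg_sum (S : subringClosed A) (H : {group gT}) :
    {subset L <= S} -> hereditary (subring S) -> (H <| [set: gT])%g ->
  #|H|%:R^-1 *: galg_sum K H \in S.
Proof.
move=> LS hS nH.
have H0 : #|H|%:R != 0 :> K.
  have /p_natP[k ->] : p.-nat #|H| by exact: pgroupS (subsetT H) pG.
  by rewrite natrX expf_neq0.
have Sx : galg_sum K H \in S by apply: LS; exact: galg_sum_int.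
have [e ex eP] := hereditary_principal (Subring Sx) hS.
have {}ex : \val e * galg_sum K H = galg_sum K H.
  by have := congr1 val ex; rewrite rmorphM.
have eH h : h \in H -> galg_elt K h * \val e = \val e.
  move=> Hh; have Sh : galg_elt K h \in S by apply: LS; exact: galg_elt_int.
  have /(congr1 val) : Subring Sh * e = 1 * e.
    apply: eP; apply: val_inj; rewrite !rmorphM rmorph1 mul1r /=.
    by apply/ffunP => k; rewrite galg_elt_mulE !ffunE groupMl ?groupV.
  by rewrite mul1r rmorphM.
have -> : #|H|%:R^-1 *: galg_sum K H = \val e; last exact: subring_valP.
rewrite -ex galg_sum_central // galg_sumE mulr_suml (eq_bigr _ eH).
by rewrite sumr_const -scaler_nat scalerA mulVf // scale1r.
Qed.

(** * The idealizer Gamma of the radical of the group ring *)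

Hypothesis p_dvd : (p %| #|gT|)%N.

Local Notation Gamma := (idealizer (jacobson_of L)).
Local Notation Delta := (idealizer (jacobson_of Gamma)).
Local Notation s := (p%:R^-1 *: galg_sum K [set: gT]).

Lemma galg_aug_s : galg_aug s = #|gT|%:R / p%:R.
Proof. by rewrite galg_augZ galg_aug_sum cardsT mulrC. Qed.

Lemma s_mull a : s * a = galg_aug a *: s.
Proof. by rewrite -scalerAl galg_sumT_mull !scalerA mulrC. Qed.

Lemma s_mulr a : a * s = galg_aug a *: s.
Proof. by rewrite -scalerAr galg_sumT_mulr !scalerA mulrC. Qed.

(** Test [a] on radical elements: p gives [p * a] in [L], and [g^-1 - 1] shows that the coefficients
    at [g] and 1 differ by an integer, so [r = p * a 1] works. Conversely [s] multiplies [x] to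
    [galg_aug x *: s], which stays in the radical as p divides both [galg_aug x] and the group
    order. *)
Lemma gammaP a : reflect (exists2 r, r \in O & a - r *: s \in L) (a \in Gamma).
Proof.
apply: (iffP (idealizerP _ _)) => [aJ|[r Or Lar] x].
  have Ja x : x \in jacobson_of L -> a * x \in L.
    by move=> /aJ[+ _]; rewrite jacobson_int => /andP[].
  have Jp : p%:R%:A \in jacobson_of L.
    rewrite jacobson_int scaler_nat rpredMn ?rpred1 //.
    by rewrite rmorphMn rmorph1 divff ?rpred1.
  exists (p%:R * a 1%g).
    have /galg_intP/(_ 1%g) := Ja _ Jp.
    by rewrite -scalerAr mulr1 ffunE.
  apply/galg_intP => g.
  have Jg : galg_elt K g^-1 - 1 \in jacobson_of L.
    rewrite jacobson_int rpredB ?rpred1 ?galg_elt_int //.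
    by rewrite rmorphB rmorph1 /= galg_aug_elt subrr mul0r rpred0.
  have /galg_intP/(_ 1%g) := Ja _ Jg.
  rewrite mulrBr mulr1 ffunE galg_mul_eltE invgK mul1g !ffunE inE.
  by rewrite scalerA mulrAC divff // mul1r [_ *: 1]mulr1.
rewrite !jacobson_int => /andP[Lx xp].
have aE : a = (a - r *: s) + r *: s by rewrite subrK.
have sx : r *: (galg_aug x *: s) =
    (r * (galg_aug x / p%:R)) *: galg_sum K [set: gT].
  by rewrite !scalerA mulrA.
have Lsx : r *: (galg_aug x *: s) \in L.
  by rewrite sx; apply: galg_int_scale (galg_sum_int _); exact: rpredM.
have asx : galg_aug (r *: (galg_aug x *: s)) / p%:R \in O.
  rewrite sx galg_augZ galg_aug_sum cardsT -mulrA.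
  by apply: rpredM; [exact: rpredM | rewrite (natr_divp KO)].
have ax : galg_aug ((a - r *: s) * x) / p%:R \in O.
  by rewrite rmorphM -mulrA; apply: rpredM => //; exact: galg_aug_int.
have xa : galg_aug (x * (a - r *: s)) / p%:R \in O.
  by rewrite rmorphM mulrAC; apply: rpredM => //; exact: galg_aug_int.
rewrite aE mulrDl mulrDr -scalerAl -scalerAr s_mull s_mulr.
by split; apply/andP; split;
  rewrite ?[galg_aug (_ + _)]rmorphD ?(mulrDl _ _ p%:R^-1);
  apply: rpredD => //; apply: rpredM.
Qed.

Lemma int_gamma : {subset L <= Gamma}.
Proof.
by move=> a La; apply/gammaP; exists 0; rewrite ?rpred0 // scale0r subr0.
Qed.

Lemma s_gamma : s \in Gamma.
Proof. by apply/gammaP; exists 1; rewrite ?rpred1 // scale1r subrr rpred0. Qed.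

Lemma gamma_scale a : a \in Gamma -> p%:R *: a \in L.
Proof.
move=> /gammaP[r Or La]; rewrite -(subrK (r *: s) a) scalerDr.
rewrite scaler_nat rpredD ?rpredMn // scalerA mulrC scalerA mulfK //.
by rewrite galg_int_scale ?galg_sum_int.
Qed.

Lemma gamma_sub a g h : a \in Gamma -> a g - a h \in O.
Proof.
move=> /gammaP[r Or /galg_intP La].
by have := rpredB (La g) (La h); rewrite !ffunE !inE opprB addrA subrK.
Qed.

(** Gamma would contain the average over the whole group, whose coefficients [1 / #|gT|] become
    integral on multiplication by p only if the order is at most p. *)
Lemma hereditary_gamma_card : hereditary (subring Gamma) -> #|gT| = p.
Proof.
move=> hG.
have /p_natP[[|[|n]] cG] : p.-nat #|gT| by rewrite -cardsT.
- by move: p_dvd; rewrite cG expn0 dvdn1 => /eqP p1; move: p_pr; rewrite p1.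
- by rewrite cG expn1.
have := hereditary_galg_sum (H := [group of [set: gT]]) int_gamma hG
  (normal_refl _).
move=> /gamma_scale/galg_intP/(_ 1%g); rewrite !ffunE inE cardsT.
rewrite [_ *: (_ *: _)]mulrA [_ * 1]mulr1 cG expnS natrM invfM mulVKf //.
move=> /(rpredM (rpred_nat O (p ^ n))); rewrite expnSr natrM invfM mulrA mulfV.
  by rewrite mul1r (negPf (padic_like_invp KO)).
by rewrite natrX expf_neq0.
Qed.

(** * Locality of Gamma and its second idealizer Delta *)

Hypothesis p2_dvd : (p ^ 2 %| #|gT|)%N.

Lemma galg_aug_gamma a : a \in Gamma -> galg_aug a \in O.
Proof.
move=> /gammaP[r Or La]; rewrite -(subrK (r *: s) a) rmorphD /=.
rewrite galg_augZ galg_aug_s; apply: rpredD; first exact: galg_aug_int.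
by apply: rpredM => //; rewrite (natr_divp KO).
Qed.

Lemma galg_aug_s_divp : galg_aug s / p%:R \in O.
Proof.
rewrite galg_aug_s; have /dvdnP[m ->] := p2_dvd.
by rewrite natrM natrX expr2 mulrA !mulfK // rpred_nat.
Qed.

(** As p divides [galg_aug s], the integral part of [a] is left invertible, which reduces [a] to
    [1 + q *: s]. Multiplying by [1 - q *: s] leaves [1 - q ^+ 2 * galg_aug s *: s], of the form
    [1 - p w] with [w] in Gamma. *)
Lemma gamma_linv a : a \in Gamma -> galg_aug a / p%:R \notin O ->
  exists2 t, t \in Gamma & t * a = 1.
Proof.
move=> /gammaP[r Or Lb]; set b := a - r *: s in Lb.
have aE : a = b + r *: s by rewrite subrK.
rewrite {1}aE rmorphD mulrDl /= galg_augZ -mulrA rpredDr; last first.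
  by apply: rpredM => //; exact: galg_aug_s_divp.
move=> /(galg_int_linv Lb)[t Lt tb].
pose q := r * galg_aug t.
have Oq : q \in O by apply: rpredM => //; exact: galg_aug_int.
have ta : t * a = 1 + q *: s.
  by rewrite aE mulrDr tb -scalerAr s_mulr scalerA.
pose w := (q ^+ 2 * (galg_aug s / p%:R)) *: s.
have Gw : w \in Gamma.
  apply/gammaP; exists (q ^+ 2 * (galg_aug s / p%:R));
    last by rewrite subrr rpred0.
  by apply: rpredM; rewrite ?rpredX // galg_aug_s_divp.
have [|u Gu uE] := @galg_geometric Gamma 1 w int_gamma _ Gw.
  by move=> x /gamma_scale; rewrite expr1.
have Gqs : q *: s \in Gamma by apply/gammaP; exists q; rewrite ?subrr ?rpred0.
exists (u * (1 - q *: s) * t).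
  apply: rpredM (int_gamma Lt); apply: rpredM => //.
  by apply: rpredB Gqs; exact: rpred1.
rewrite -(mulrA _ t) ta -mulrA -[RHS]uE; congr (_ * _).
rewrite mulrDr mulr1 mulrBl mul1r -scalerAl -scalerAr s_mull.
rewrite addrA subrK /w !scalerA; congr (_ - _ *: _).
by rewrite mulrC [RHS]mulrAC mulfV // mul1r -expr2 mulrC mulrA.
Qed.

Lemma jacobson_gamma a : (a \in jacobson_of Gamma) =
  (a \in Gamma) && (galg_aug a / p%:R \in O).
Proof.
by apply: jacobson_of_aug => [b|b Gb];
  [exact: galg_aug_gamma | exact: gamma_linv].
Qed.

Lemma gamma_delta : {subset Gamma <= Delta}.
Proof.
move=> a Ga; apply/idealizerP => x; rewrite !jacobson_gamma => /andP[Gx xp].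
have Oa := galg_aug_gamma Ga.
split; apply/andP; (split; first exact: rpredM); rewrite rmorphM.
  by rewrite -mulrA; apply: rpredM.
by rewrite mulrAC; apply: rpredM.
Qed.

Lemma delta_mulr a x : a \in Delta -> x \in L -> galg_aug x / p%:R \in O ->
  a * x \in Gamma /\ galg_aug (a * x) / p%:R \in O.
Proof.
move=> /idealizerP aM Lx xp.
have [|+ _] := aM x; first by rewrite jacobson_gamma int_gamma.
by rewrite jacobson_gamma => /andP.
Qed.

Lemma delta_scale a : a \in Delta -> p%:R ^+ 2 *: a \in L.
Proof.
move=> Da; have [||+ _] := @delta_mulr a p%:R%:A Da.
- by rewrite scaler_nat rpredMn ?rpred1.
- by rewrite scaler_nat rmorphMn rmorph1 divff ?rpred1.
by move=> /gamma_scale; rewrite -scalerAr mulr1 scalerA.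
Qed.

(** Delta would contain the average [e] over a central subgroup [H] of order p. Then [e * (g - 1)]
    with [g] outside [H] lies in Gamma, although it has coefficient [- 1 / p] at 1 and 0 on a third
    coset. *)
Lemma hereditary_delta_card : hereditary (subring Delta) -> #|gT| = 4.
Proof.
move=> hD; apply/eqP; apply: contraT => card4.
have ntG : [set: gT] != 1%g.
  apply: contraTneq p_dvd => G1; rewrite -cardsT G1 cards1 dvdn1.
  by rewrite neq_ltn prime_gt1 ?orbT.
have pZ := pgroupS (center_sub [set: gT]) pG.
have [|_ dvZ _] := pgroup_pdiv pZ.
  by rewrite center_nil_eq1 ?(pgroup_nil pG).
have [z Zz oz] := Cauchy p_pr dvZ.
pose H := <[z]>%G.
have nH : (H <| [set: gT])%g by rewrite sub_center_normal // cycle_subG.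
have := hereditary_galg_sum (fun a La => gamma_delta (int_gamma La)) hD nH.
have cH : #|H| = p by rewrite -oz.
rewrite cH => De.
(* A third coset exists: a multiple of p^2 that is at most 2p forces p = 2 and order 4. *)
have lt_2p : (2 * p < #|gT|)%N.
  rewrite ltnNge; apply: contra card4 => le_2p; have p_gt1 := prime_gt1 p_pr.
  have /dvdnP[m mE] := p2_dvd; move: le_2p; rewrite mE expnS expn1 mulnA.
  rewrite leq_pmul2r ?prime_gt0 // => le2; case: m mE le2 => [|[|m]] mE le2.
  - by move: (cardG_gt0 [set: gT]); rewrite cardsT mE.
  - by rewrite mul1n in le2; rewrite (_ : p = 2) //; apply/eqP;
      rewrite eqn_leq le2.
  - by move: (leq_trans (leq_mul (isT : (1 < m.+2)%N) p_gt1) le2).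
have ex_notin (B : {set gT}) : (#|B| < #|gT|)%N -> exists g, g \notin B.
  rewrite -cardsT => ltB; have /subsetPn[g _ gB] : ~~ ([set: gT] \subset B).
    by apply: contraL ltB => /subset_leq_card; rewrite -leqNgt.
  by exists g.
have [|g gH] := ex_notin H.
  by rewrite cH (leq_trans _ lt_2p) // ltnS leq_pmull.
have [|k] := ex_notin (H :|: (H :* g)%g).
  apply: leq_ltn_trans lt_2p; apply: leq_trans (leq_card_setU _ _) _.
  by rewrite card_rcoset cH mul2n addnn.
rewrite in_setU mem_rcoset negb_or => /andP[kH kgH].
have [||De_g _] := @delta_mulr _ (galg_elt K g - 1) De.
- by rewrite rpredB ?rpred1 // galg_elt_int.
- by rewrite rmorphB rmorph1 /= galg_aug_elt subrr mul0r rpred0.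
have := gamma_sub k 1%g De_g.
rewrite mulrBr mulr1 ffunE [X in _ - X]ffunE !galg_mul_eltE !ffunE.
rewrite (negPf kH) (negPf kgH) mul1g groupV (negPf gH) group1 scaler0.
by rewrite subr0 !sub0r opprK [_ *: 1]mulr1 (negPf (padic_like_invp KO)).
Qed.

End IntegralGroupAlgebra.

(** * Discretely valued components *)

Section AbelianComponents.
Variables (K : fieldType) (O : subringClosed K) (p : nat) (gT : finGroupType).
Local Notation A := (group_algebra K gT).
Variable L : subringClosed A.
Hypothesis KO : padic_like O p.
Hypothesis pG : (p.-group [set: gT])%g.
Hypothesis LE : forall a, (a \in L) = [forall g, a g \in O].
Hypothesis abG : abelian [set: gT].
Implicit Types (a b x e : A) (r : K).

Let p_pr : prime p := padic_like_prime KO.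
Let p0 : p%:R != 0 :> K := padic_like_p_neq0 KO.
Let galg_intP := galg_intP LE.
Let galg_int_scale := galg_int_scale LE.
Let galg_aug_int := galg_aug_int LE.
Let mulAC a b : a * b = b * a := galg_mulC a b abG.

Let mulAAC a b x : a * b * x = a * x * b.
Proof. by rewrite -!mulrA (mulAC b). Qed.

(** Encodes that [L e], for nonzero [e], is a discrete valuation ring with uniformizer [pi e]: [pi']
    inverts [pi] on the component, and the last clause puts the radical of [L], cut by [e], into
    [pi L e]. *)
Definition dvr_component e (pi pi' : A) : Prop :=
  [/\ e * e = e, pi' * pi = e, pi \in L, galg_aug pi / p%:R \in O &
      forall a, a \in L -> galg_aug a / p%:R \in O ->
        exists2 b, b \in L & a * e = pi * b * e].

Section Dvr.
Variables (S : subringClosed A) (c : nat) (e pi pi' : A).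
Hypothesis LS : {subset L <= S}.
Hypothesis Le : p%:R ^+ c *: e \in L.
Hypothesis e_dvr : dvr_component e pi pi'.
Hypothesis Se : e \in S.
Hypothesis SLe : forall a, a \in S -> exists2 b, b \in L & a * e = b * e.

Let pi_expK k : pi' ^+ k * pi ^+ k * e = e.
Proof.
have [ee pi'K _ _ _] := e_dvr.
rewrite -exprMn_comm; last exact: mulAC.
by rewrite pi'K; elim: k => [|k IHk]; rewrite ?expr0 ?mul1r // exprS -mulrA IHk.
Qed.

(** Divide by [pi] as long as the cofactor is in the radical. Since some power of [pi] lies in
    [p L], endless division would make [a * e], up to the denominator [p ^ c], divisible by all
    powers of p, hence zero. *)
Lemma dvr_component_factor a : a \in L -> a * e != 0 ->
  exists k : nat, exists2 u, u \in L & galg_aug u / p%:R \notin O /\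
    a * e = pi ^+ k * u * e.
Proof.
move=> La ae0; have [ee pi'K Lpi pi_p maxe] := e_dvr.
apply: contrapT => no_k; case/eqP: ae0.
have divk k : exists2 b, b \in L & a * e = pi ^+ k * b * e.
  elim: k => [|k [b Lb abE]]; first by exists a; rewrite ?expr0 ?mul1r.
  have [bp|bN] := boolP (galg_aug b / p%:R \in O); last first.
    by case: no_k; exists k, b.
  have [d Ld bd] := maxe b Lb bp; exists d => //.
  by rewrite abE -mulrA bd exprSr !mulrA.
have [m Lpim] := galg_int_nilpotent KO pG LE Lpi pi_p.
apply/ffunP => g; rewrite [RHS]ffunE.
have : p%:R ^+ c * (a * e) g = 0.
  apply: (padic_like_separated KO) => j.
  have [b Lb ->] := divk (m * j)%N.
  have -> : p%:R ^+ c * (pi ^+ (m * j) * b * e) g / p%:R ^+ j =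
      ((p%:R^-1 *: pi ^+ m) ^+ j * b * (p%:R ^+ c *: e)) g.
    rewrite exprZn -exprM exprVn -!scalerAl -scalerAr scalerA !ffunE.
    by rewrite mulrAC mulrC [_ *: _]mulrC [p%:R ^- j * _]mulrC.
  by apply: galg_intP; rewrite rpredM // rpredM // rpredX.
by move/eqP; rewrite mulf_eq0 (negPf (expf_neq0 _ p0)) => /eqP.
Qed.

(** Choose [x] in [I] with [x * e = pi ^+ k * u * e], [u] a unit with inverse [v] and [k] minimal;
    then [q = pi' ^+ k * v * e] inverts it. Minimality keeps [a * q] in [S] for all [a] in [I]. If
    [I e] is zero, take [x = q = 0]. *)
Lemma hereditary_at_dvr : hereditary_at S e.
Proof.
move=> I; have [ee pi'K Lpi pi_p maxe] := e_dvr.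
pose P k := exists2 x : subring S, x \in I & exists2 u, u \in L &
  galg_aug u / p%:R \notin O /\ \val x * e = pi ^+ k * u * e.
have factor (x : subring S) : x \in I -> \val x * e != 0 -> exists k, P k.
  move=> Ix xe0; have [b Lb xb] := SLe (subring_valP x).
  move: xe0; rewrite xb => /(dvr_component_factor Lb)[k [u Lu [uN bu]]].
  by exists k, x => //; exists u => //; rewrite xb.
have [[x0 Ix0 x0e]|I0] := pselect (exists2 x, x \in I & \val x * e != 0);
  last first.
  exists 0; first exact: (@rpred0 (subring S)^o).
  exists 0 => a Ia; rewrite mulr0 rpred0 mul0r; split=> //.
  by apply/esym/eqP/negP => /negP ae0; apply: I0; exists a.
have exP : exists k, `[< P k >].
  by have [k Pk] := factor x0 Ix0 x0e; exists k; apply/asboolP.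
case: (ex_minnP exP) => k /asboolP[x Ix [u Lu [uN xu]]] kmin.
have [v Lv vu] := galg_int_linv KO pG LE Lu uN.
exists x => //; exists (pi' ^+ k * v * e) => a Ia; split; last first.
  rewrite -!mulrA; congr (_ * _).
  rewrite [e * _]mulAC xu !mulrA (mulAAC _ v) -(mulrA _ v u) vu mulr1.
  exact: pi_expK.
have -> : \val a * (pi' ^+ k * v * e) = \val a * e * (pi' ^+ k * v).
  by rewrite -[RHS]mulrA; congr (_ * _); exact: mulAC.
have [->|ae0] := eqVneq (\val a * e) 0; first by rewrite mul0r rpred0.
have [b Lb ab] := SLe (subring_valP a).
have := ae0; rewrite ab => /(dvr_component_factor Lb)[l [w Lw [wN bw]]].
have kl : (k <= l)%N.
  by apply: kmin; apply/asboolP; exists a => //; exists w; rewrite ?ab.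
rewrite bw -(subnK kl) exprD.
have -> : pi ^+ (l - k) * pi ^+ k * w * e * (pi' ^+ k * v) =
    pi ^+ (l - k) * w * v * (pi' ^+ k * pi ^+ k * e).
  rewrite (mulAAC _ _ w) -!(mulrA (_ * w)); congr (_ * _).
  by rewrite [pi' ^+ k * v]mulAC [LHS]mulAC !mulrA.
rewrite pi_expK; apply: rpredM Se; apply: LS.
by rewrite !rpredM ?rpredX.
Qed.

End Dvr.
(** For a cyclic group the augmentation ideal is generated by [1 - g], since each [g ^+ i - 1] is a
    multiple of [g - 1]. *)
Lemma sub_aug_cyclic (g : gT) a : (forall h, exists i, h = (g ^+ i)%g) ->
  a \in L -> exists2 b, b \in L & a - (galg_aug a)%:A = (1 - galg_elt K g) * b.
Proof.
move=> gen_g La; have /fin_all_exists[i iE] := gen_g.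
exists (- \sum_h a h *: \sum_(j < i h) galg_elt K g ^+ j).
  rewrite rpredN rpred_sum // => h _; apply: galg_int_scale;
    first exact: galg_intP.
  by rewrite rpred_sum // => j _; rewrite rpredX // (galg_elt_int LE).
rewrite mulrN -mulNr opprB mulr_sumr {1}[a]galg_basis scaler_suml -sumrB.
apply: eq_bigr => h _; rewrite -scalerAr -scalerBr; congr (_ *: _).
by rewrite -subrX1 -galg_eltX -iE.
Qed.

(** An element of augmentation in [p O] is a multiple of [1 - g] plus a multiple of p, and on this
    component p is itself a multiple of [1 - g]. *)
Lemma dvr_component_cyclic (g : gT) (w e : A) :
    (forall h, exists i, h = (g ^+ i)%g) -> e * e = e -> w \in L ->
    p%:R *: e = (1 - galg_elt K g) * w * e ->
  dvr_component e (1 - galg_elt K g) (p%:R^-1 *: (w * e)).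
Proof.
move=> gen_g ee Lw pe; split=> //.
- by rewrite -scalerAl [w * e * _]mulAC mulrA -pe scalerA mulVf // scale1r.
- by rewrite rpredB ?rpred1 ?(galg_elt_int LE).
- by rewrite rmorphB rmorph1 /= galg_aug_elt subrr mul0r rpred0.
move=> a La ap; have [b Lb ab] := sub_aug_cyclic gen_g La.
exists (b + (galg_aug a / p%:R) *: w); first by rewrite rpredD ?galg_int_scale.
rewrite mulrDr mulrDl -ab -scalerAr -scalerAl -pe scalerA divfK //.
by rewrite mulrBl -scalerAl mul1r subrK.
Qed.

(** Each group element acts on [e] by a scalar congruent to 1 modulo p, so [a] acts by a scalar
    congruent to its augmentation; the uniformizer is p. *)
Lemma dvr_component_rank1 e :
    e * e = e ->
    (forall g, exists2 r, (r - 1) / p%:R \in O & galg_elt K g * e = r *: e) ->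
  dvr_component e p%:R%:A (p%:R^-1 *: e).
Proof.
move=> ee eg; split=> //.
- by rewrite -scalerAl -scalerAr mulr1 scalerA mulVf // scale1r.
- by rewrite galg_int_scale ?rpred_nat ?rpred1.
- by rewrite scaler_nat rmorphMn rmorph1 divff ?rpred1.
move=> a La ap; have /fin_all_exists[f fP] g : exists r,
    (r - 1) / p%:R \in O /\ galg_elt K g * e = r *: e.
  by have [r] := eg g; exists r.
pose r := \sum_g a g * f g.
have ae : a * e = r *: e.
  rewrite {1}[a]galg_basis mulr_suml scaler_suml; apply: eq_bigr => g _.
  by rewrite -scalerAl (fP g).2 scalerA.
have rp : r / p%:R \in O.
  rewrite -(subrK (galg_aug a) r) mulrDl rpredD // -sumrB mulr_suml.
  rewrite rpred_sum // => g _; rewrite -[X in _ - X]mulr1 -mulrBr -mulrA.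
  by apply: rpredM (fP g).1; apply: galg_intP.
exists (r / p%:R)%:A; first by rewrite galg_int_scale ?rpred1.
by rewrite ae -!scalerAl mul1r -scalerAl mul1r scalerA mulrCA mulfV // mulr1.
Qed.

Section Idealizers.
Hypothesis p_dvd : (p %| #|gT|)%N.

Local Notation Gamma := (idealizer (jacobson_of L)).
Local Notation Delta := (idealizer (jacobson_of Gamma)).
Local Notation s := (p%:R^-1 *: galg_sum K [set: gT]).

(** Here [s] is the idempotent of the trivial character; [s] and [1 - s] cut out Z_p and
    Z_p[zeta_p]. *)
Lemma hereditary_gamma : #|gT| = p -> hereditary (subring Gamma).
Proof.
move=> cG; have aug_s : galg_aug s = 1 by rewrite galg_aug_s cG divff.
have ss : s * s = s by rewrite s_mull aug_s scale1r.
have [g gen_g] : exists g, forall h : gT, exists i, h = (g ^+ i)%g.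
  have /cyclicP[g gE] : cyclic [set: gT] by rewrite prime_cyclic // cardsT cG.
  by exists g => h; apply/cycleP; rewrite -gE inE.
(* The norm element minus p equals [(1 - g) * w]; as [1 - s] kills the norm element, p becomes
   [(1 - g) * - w] on that component. *)
have [w Lw wE] := sub_aug_cyclic gen_g (galg_sum_int LE [set: gT]).
have Gs := s_gamma KO pG LE p_dvd.
have LG := int_gamma KO pG LE p_dvd.
have LpG a : a \in Gamma -> p%:R ^+ 1 *: a \in L.
  by rewrite expr1; exact: (gamma_scale KO pG LE p_dvd).
have Gs' : 1 - s \in Gamma by rewrite rpredB ?rpred1.
have s1s : s * (1 - s) = 0 by rewrite mulrBr mulr1 ss subrr.
pose e (b : bool) := if b then s else 1 - s.
apply: (@hereditary_sum _ _ _ e) => [|[]].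
- by rewrite big_bool /= addrC subrK.
- apply: (@hereditary_at_dvr Gamma 1 s p%:R%:A (p%:R^-1 *: s)) => //.
  + exact: LpG.
  + apply: dvr_component_rank1 => // h; exists 1.
      by rewrite subrr mul0r rpred0.
    by rewrite scale1r s_mulr galg_aug_elt scale1r.
  move=> a /(gammaP KO pG LE p_dvd)[r Or Lr].
  exists ((a - r *: s) + r%:A).
    by rewrite rpredD // galg_int_scale ?rpred1.
  by rewrite mulrDl mulrBl -!(scalerAl r) ss mul1r subrK.
- apply: (@hereditary_at_dvr Gamma 1 (1 - s) (1 - galg_elt K g)
    (p%:R^-1 *: (- w * (1 - s)))) => //; first exact: LpG.
  apply: dvr_component_cyclic; rewrite ?rpredN //.
    by rewrite mulrBl mul1r s1s subr0.
  rewrite mulrN -wE galg_aug_sum cardsT cG opprB mulrBl -scalerAl mul1r.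
  by rewrite galg_sumT_mull rmorphB rmorph1 /= aug_s subrr scale0r subr0.
  move=> a /(gammaP KO pG LE p_dvd)[r Or Lr]; exists (a - r *: s) => //.
  by rewrite (mulrBl _ a) -(scalerAl r) s1s scaler0 subr0.
Qed.

Hypothesis p2_dvd : (p ^ 2 %| #|gT|)%N.

(** It suffices that [Delta e] lies in [L e]. For [a] in Delta, [a * pi] is in the radical of Gamma,
    so it is [b + r *: s] with p dividing [galg_aug b]; both terms, cut by [e], lie in [pi L e], and
    [pi] cancels. *)
Lemma hereditary_at_delta e pi pi' : dvr_component e pi pi' -> e \in Delta ->
    (exists2 b, b \in L & s * e = pi * b * e) -> hereditary_at Delta e.
Proof.
move=> edvr De [b1 Lb1 se]; have [ee pi'K Lpi pi_p maxe] := edvr.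
apply: (@hereditary_at_dvr Delta 2 e pi pi') => // [a La||a Da].
- exact/(gamma_delta KO pG LE p_dvd p2_dvd)/(int_gamma KO pG LE p_dvd).
- exact: (delta_scale KO pG LE p_dvd p2_dvd).
have [] := delta_mulr KO pG LE p_dvd p2_dvd Da Lpi pi_p.
move=> /(gammaP KO pG LE p_dvd)[r Or Lr] ap.
have [|b Lb be] := maxe _ Lr.
  rewrite rmorphB /= galg_augZ mulrBl -mulrA rpredB //; apply: rpredM => //.
  exact: galg_aug_s_divp.
exists (b + r *: b1); first by rewrite rpredD ?galg_int_scale.
have piE : a * pi * e = pi * ((b + r *: b1) * e).
  rewrite -(subrK (r *: s) (a * pi)) mulrDl be -scalerAl se.
  by rewrite mulrDl mulrDr -!scalerAl -scalerAr !mulrA.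
have := congr1 (fun x => pi' * x) piE.
have -> : a * pi * e = pi * (a * e) by rewrite (mulAC a) mulrA.
by rewrite !mulrA pi'K -2!(mulrA e) ![e * (_ * e)]mulAC -!mulrA ee.
Qed.

End Idealizers.

End AbelianComponents.

(** * Groups of order 4 *)

(** Take [z] of order 2 and [h] outside its span. [h * h = 1] is the Klein four-group, [h * h = z]
    the cyclic group generated by [h]. *)
Lemma order4_elements (gT : finGroupType) : #|gT| = 4 ->
  exists z h : gT, [/\ (z * z = 1)%g, (h * h = 1)%g \/ (h * h = z)%g,
    uniq [:: 1; z; h; h * z]%g & forall g, g \in [:: 1; z; h; h * z]%g].
Proof.
move=> c4; have [|z _ oz] := @Cauchy gT 2 [group of [set: gT]] isT.
  by rewrite cardsT c4.
have zz : (z * z = 1)%g by have := expg_order z; rewrite oz expgS expg1.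
have z1 : z != 1%g by rewrite -order_gt1 oz.
have [h hz] : exists h, h \notin <[z]>%g.
  have /subsetPn[h _ hz] : ~~ ([set: gT] \subset <[z]>%g).
    by apply/negP => /subset_leq_card; rewrite cardsT c4 -[#|_|]/(#[z]%g) oz.
  by exists h.
have h1 : h != 1%g by apply: contraNneq hz => ->; exact: group1.
have hnz : h != z by apply: contraNneq hz => ->; exact: cycle_id.
have n1 : (1 != h * z)%g.
  by apply: contraNneq hz => e; rewrite -(groupMr h (cycle_id z)) -e group1.
have n2 : (z != h * z)%g.
  by apply: contraNneq hz => e; rewrite -(groupMr h (cycle_id z)) -e cycle_id.
have n3 : (h != h * z)%g.
  by apply: contraNneq z1 => e; apply/eqP; apply: (mulgI h); rewrite mulg1 -e.
have un : uniq [:: 1; z; h; h * z]%g.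
  rewrite /= !inE !negb_or n1 n2 n3 (eq_sym 1%g z) z1 (eq_sym 1%g h) h1.
  by rewrite eq_sym hnz.
have all4 g : g \in [:: 1; z; h; h * z]%g.
  have /subset_cardP : #|[:: 1; z; h; h * z]%g| = #|gT|.
    by rewrite c4; apply/card_uniqP.
  by move=> /(_ (subset_predT _)) ->.
exists z, h; split=> //.
have := all4 (h * h)%g; rewrite !inE => /or4P[] /eqP hh; first by left.
- by right.
- by case/eqP: h1; apply: (mulgI h); rewrite mulg1.
- by case/eqP: hnz; apply: (mulgI h).
Qed.

Lemma big_order4 (gT : finGroupType) (V : nmodType) (z h : gT) (F : gT -> V) :
    uniq [:: 1; z; h; h * z]%g -> (forall g, g \in [:: 1; z; h; h * z]%g) ->
  \sum_g F g = F 1%g + F z + F h + F (h * z)%g.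
Proof.
move=> un all4; rewrite (eq_bigl (mem [:: 1; z; h; h * z]%g)) => [|g].
  by rewrite -big_uniq //= !big_cons big_nil addr0 !addrA.
by rewrite [RHS]all4.
Qed.

Section Order4.
Variables (K : fieldType) (O : subringClosed K) (gT : finGroupType).
Local Notation A := (group_algebra K gT).
Variable L : subringClosed A.
Hypothesis KO : padic_like O 2.
Hypothesis LE : forall a, (a \in L) = [forall g, a g \in O].
Hypothesis card4 : #|gT| = 4.
Implicit Types (a b x e : A) (r : K).

Let pG : (2.-group [set: gT])%g.
Proof. by rewrite /pgroup cardsT card4. Qed.
Let abG : abelian [set: gT].
Proof. by apply: (card_p2group_abelian (p := 2)); rewrite // cardsT card4. Qed.
Let p_dvd : (2 %| #|gT|)%N.
Proof. by rewrite card4. Qed.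
Let p2_dvd : (2 ^ 2 %| #|gT|)%N.
Proof. by rewrite card4. Qed.

Let n2 : 2%:R != 0 :> K := padic_like_p_neq0 KO.
Let galg_intP := galg_intP LE.
Let mulAC a b : a * b = b * a := galg_mulC a b abG.

Local Notation Gamma := (idealizer (jacobson_of L)).
Local Notation Delta := (idealizer (jacobson_of Gamma)).
Local Notation s := (2%:R^-1 *: galg_sum K [set: gT] : A).
Local Notation E := (galg_elt K).
Local Notation half g := (2%:R^-1 *: (1 + E g) : A).

Lemma aug_s4 : galg_aug s = 2%:R.
Proof. by rewrite galg_aug_s card4 (natrM _ 2 2) mulfK. Qed.

Lemma half_aug g : galg_aug (half g) = 1.
Proof. by rewrite galg_augZ rmorphD rmorph1 /= galg_aug_elt mulVf. Qed.

Lemma half_fixed g : (g * g = 1)%g -> E g * half g = half g.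
Proof.
move=> gg; rewrite -scalerAr mulrDr mulr1 -galg_eltM gg galg_elt1.
by rewrite [1 + _]addrC.
Qed.

Lemma half_idem g : (g * g = 1)%g -> half g * half g = half g.
Proof.
move=> gg; rewrite -[LHS]scalerAl mulrDl mul1r half_fixed // -mulr2n.
by rewrite -scaler_nat scalerA mulVf // scale1r.
Qed.

(** Multiplication by [half y] fixes [s] and averages the integral part [b] over the two cosets of
    [y]. The two averages differ by an integer because the augmentation of [b] is even, so the
    product is a multiple of [s] plus an integral element. *)
Lemma half_delta (y k : gT) : (y * y = 1)%g ->
    uniq [:: 1; y; k; k * y]%g -> (forall g, g \in [:: 1; y; k; k * y]%g) ->
  half y \in Delta.
Proof.
move=> yy un all4; apply/idealizerP => x Mx.
rewrite (mulAC x); suff: half y * x \in jacobson_of Gamma by [].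
move: Mx; rewrite !(jacobson_gamma KO pG LE p_dvd p2_dvd) => /andP[Gx xp].
rewrite rmorphM /= half_aug mul1r xp andbT.
have /(gammaP KO pG LE p_dvd)[r Or Lb] := Gx; set b := x - r *: s in Lb.
have xE : x = b + r *: s by rewrite subrK.
have bO g : b g \in O by exact: galg_intP.
have bp : galg_aug b / 2%:R \in O.
  by rewrite rmorphB /= galg_augZ aug_s4 mulrBl mulfK // rpredB.
apply/(gammaP KO pG LE p_dvd); exists (r + (b 1%g + b y)).
  by rewrite !rpredD.
have -> : half y * x - (r + (b 1%g + b y)) *: s =
    half y * b - (b 1%g + b y) *: s.
  rewrite xE mulrDr -scalerAr s_mulr half_aug scale1r scalerDl opprD addrA.
  by rewrite addrK.
have -> : half y * b - (b 1%g + b y) *: s =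
    [ffun g => (b g + b (y * g)%g - (b 1%g + b y)) / 2%:R].
  have -> : half y * b = 2%:R^-1 *: (b + E y * b).
    by rewrite -scalerAl mulrDl mul1r.
  have hbE g : (2%:R^-1 *: (b + E y * b)) g = (b g + b (y * g)%g) / 2%:R.
    rewrite [LHS]ffunE [LHS]mulrC; congr (_ / _).
    rewrite [LHS]ffunE galg_elt_mulE; congr (_ + b (_ * _)%g).
    by apply: (mulgI y); rewrite mulgV yy.
  apply/ffunP => g; rewrite [LHS]ffunE hbE !ffunE inE mulrBl.
  by rewrite [2%:R^-1 *: 1]mulr1.
have cyk : (y * k = k * y)%g by apply: (centsP abG); rewrite inE.
have kO : (b k + b (k * y)%g - (b 1%g + b y)) / 2%:R \in O.
  have -> : b k + b (k * y)%g - (b 1%g + b y) =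
      galg_aug b - (b 1%g + b y) * 2%:R.
    by rewrite /galg_aug (big_order4 _ un all4); ring.
  by rewrite mulrBl mulfK // rpredB // rpredD.
apply/galg_intP => g; rewrite ffunE; have := all4 g.
rewrite !inE => /or4P[] /eqP ->.
- by rewrite mulg1 subrr mul0r rpred0.
- by rewrite yy [b y + _]addrC subrr mul0r rpred0.
- by rewrite cyk.
- by rewrite mulgA cyk -mulgA yy mulg1 [b (k * y)%g + _]addrC.
Qed.

Lemma half_s_delta : 2%:R^-1 *: s \in Delta.
Proof.
apply/idealizerP => x; rewrite !(jacobson_gamma KO pG LE p_dvd p2_dvd).
move=> /andP[_ xp]; rewrite (mulAC x) -scalerAl s_mull scalerA mulrC.
have Gs := s_gamma KO pG LE p_dvd.
have -> : (galg_aug x / 2%:R) *: s \in Gamma.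
  by apply/(gammaP KO pG LE p_dvd); exists (galg_aug x / 2%:R);
    rewrite ?subrr ?rpred0.
by rewrite galg_augZ aug_s4 divfK // xp.
Qed.

Lemma half_s_mull a : (2%:R^-1 *: s) * a = galg_aug a *: (2%:R^-1 *: s).
Proof. by rewrite -scalerAl s_mull !scalerA; congr (_ *: _); ring. Qed.

Lemma half_s_aug : galg_aug (2%:R^-1 *: s : A) = 1.
Proof. by rewrite galg_augZ aug_s4 mulVf. Qed.

Lemma elt_half (z h : gT) :
    uniq [:: 1; z; h; h * z]%g -> (forall g, g \in [:: 1; z; h; h * z]%g) ->
  E h * half z = s - half z.
Proof.
move=> un all4; apply: (addIr (half z)); rewrite subrK -scalerAr -scalerDr.
congr (_ *: _); rewrite galg_sumE (eq_bigl predT) => [|g]; last by rewrite inE.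
rewrite (big_order4 _ un all4) mulrDr mulr1 galg_elt1 -galg_eltM [LHS]addrC.
by rewrite !addrA.
Qed.

Definition sign_eigen e : Prop := forall g : gT, E g * e = e \/ E g * e = - e.

Lemma sign_eigen_gen (z h : gT) e : (forall g, g \in [:: 1; z; h; h * z]%g) ->
    (E z * e = e \/ E z * e = - e) -> (E h * e = e \/ E h * e = - e) ->
  sign_eigen e.
Proof.
move=> all4 ze he g; have := all4 g; rewrite !inE => /or4P[] /eqP -> //.
  by left; rewrite galg_elt1 mul1r.
rewrite galg_eltM -mulrA.
by case: ze => ->; rewrite ?mulrN; case: he => ->; rewrite ?opprK; auto.
Qed.

(** Signs are congruent to 1 modulo 2, so the component has uniformizer 2; and [s * e] is zero or,
    for the trivial character, [2 e]. *)
Lemma hereditary_at_sign e : sign_eigen e -> e * e = e -> e \in Delta ->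
  galg_aug e = 0 \/ e = 2%:R^-1 *: s -> hereditary_at Delta e.
Proof.
move=> eg ee De e_aug.
apply: (hereditary_at_delta KO pG LE abG p_dvd p2_dvd _ De).
  apply: (dvr_component_rank1 KO LE ee) => g; have [->|->] := eg g.
    by exists 1; rewrite ?scale1r // subrr mul0r rpred0.
  exists (- 1); rewrite ?scaleN1r // -opprD mulNr rpredN -mulr2n divff //.
  exact: rpred1.
case: e_aug => [e0|eE].
  by exists 0; rewrite ?rpred0 // mulr0 mul0r s_mull e0 scale0r.
exists 1; rewrite ?rpred1 // mulr1 s_mull -scalerAl mul1r eE half_s_aug scale1r.
by rewrite (scalerA 2%:R) mulfV // scale1r.
Qed.

Lemma idem_sub (a b : A) : a * a = a -> b * b = b -> a * b = b ->
  (a - b) * (a - b) = a - b.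
Proof.
move=> aa bb ab; rewrite mulrBl !mulrBr (mulAC b a) aa bb ab subrr.
exact: subr0.
Qed.

Lemma idem_mul (a b : A) : a * a = a -> b * b = b -> a * b * (a * b) = a * b.
Proof.
by move=> aa bb; rewrite -mulrA (mulrA b) (mulAC b a) -mulrA bb mulrA aa.
Qed.

Lemma elt_subN (g : gT) e : E g * e = e -> 2%:R *: e = 1 + E g ->
  E g * (1 - e) = - (1 - e).
Proof.
move=> ge e2; rewrite mulrBr mulr1 ge opprB.
have -> : E g = e + e - 1 by rewrite -mulr2n -scaler_nat e2 addrC addKr.
by rewrite addrAC addrK.
Qed.

(** Split 1 into [e1] (trivial character), [ez - e1] (where [z] acts by 1 and [h] by -1) and
    [1 - ez] (where [z] acts by -1). Only the last part depends on the group. *)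
Lemma hereditary_delta : hereditary (subring Delta).
Proof.
have [z [h [zz hh un all4]]] := order4_elements card4.
have [e1 [De1 e1_mull aug_e1 e1E]] : exists e1 : A, [/\ e1 \in Delta,
    forall a, e1 * a = galg_aug a *: e1, galg_aug e1 = 1 & e1 = 2%:R^-1 *: s].
  exists (2%:R^-1 *: s); split=> // [|a|]; first exact: half_s_delta.
    exact: half_s_mull.
  exact: half_s_aug.
have [ez [Dez Ez ezz aug_ez [Ehz ez2]]] : exists ez : A, [/\ ez \in Delta,
    E z * ez = ez, ez * ez = ez, galg_aug ez = 1 &
    E h * ez = e1 + e1 - ez /\ 2%:R *: ez = 1 + E z].
  exists (half z); split; rewrite ?half_fixed ?half_idem ?half_aug //.
    exact: half_delta zz un all4.
  split; last by rewrite scalerA mulfV // scale1r.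
  rewrite (elt_half un all4) -mulr2n -scaler_nat e1E (scalerA 2%:R) mulfV //.
  by rewrite scale1r.
have e11 : e1 * e1 = e1 by rewrite e1_mull aug_e1 scale1r.
have ze1 : ez * e1 = e1 by rewrite mulAC e1_mull aug_ez scale1r.
have Ee1 (g : gT) : E g * e1 = e1 by rewrite mulAC e1_mull galg_aug_elt scale1r.
have at_e1 : hereditary_at Delta e1.
  by apply: hereditary_at_sign => //; [left | right].
have at_e2 : hereditary_at Delta (ez - e1).
  apply: hereditary_at_sign; rewrite ?rpredB ?idem_sub //.
    apply: (sign_eigen_gen all4); first by left; rewrite mulrBr Ez Ee1.
    right; rewrite mulrBr Ehz Ee1 opprB.
    rewrite -[e1 + e1 - ez]addrA [e1 + (e1 - ez)]addrC.
    by rewrite addrK.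
  by left; rewrite rmorphB /= aug_ez aug_e1 subrr.
have e3_idem : (1 - ez) * (1 - ez) = 1 - ez by rewrite idem_sub ?mul1r.
have Ez3 : E z * (1 - ez) = - (1 - ez) by exact: elt_subN.
have De3 : 1 - ez \in Delta by rewrite rpredB ?rpred1.
have aug_e3 : galg_aug (1 - ez) = 0 by rewrite rmorphB rmorph1 /= aug_ez subrr.
(* Cyclic case: [1 - ez] cuts out Z_2[i] with uniformizer [1 - h], because
   [(1 - h) * (1 + h) = 1 - z] acts there as 2. *)
case: hh => hh; last first.
  have at_e3 : hereditary_at Delta (1 - ez).
    have gen_h g : exists i, g = (h ^+ i)%g.
      have := all4 g; rewrite !inE => /or4P[] /eqP ->.
      - by exists 0%N.
      - by exists 2%N; rewrite expgS expg1 hh.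
      - by exists 1%N; rewrite expg1.
      - by exists 3%N; rewrite !expgS expg0 mulg1 hh.
    have LEh : 1 + E h \in L by rewrite rpredD ?rpred1 // (galg_elt_int LE).
    have e3_2 : 2%:R *: (1 - ez) = (1 - E h) * (1 + E h) * (1 - ez).
      have -> : (1 - E h) * (1 + E h) = 1 - E z.
        by rewrite mulrDr mulr1 mulrBl mul1r addrA subrK -galg_eltM hh.
      by rewrite mulrBl mul1r Ez3 opprK -mulr2n scaler_nat.
    have dvr3 := dvr_component_cyclic KO LE abG gen_h e3_idem LEh e3_2.
    apply: (hereditary_at_delta KO pG LE abG p_dvd p2_dvd dvr3 De3).
    by exists 0; rewrite ?rpred0 // mulr0 mul0r s_mull aug_e3 scale0r.
  pose e (i : 'I_3) := nth 0 [:: e1; ez - e1; 1 - ez] i.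
  apply: (@hereditary_sum _ _ _ e).
    by rewrite !big_ord_recl big_ord0 /e /= addr0 addrA (addrC e1) subrK
      addrC subrK.
  by case=> [[|[|[|i]]] Hi].
(* Klein case: the idempotent of [h] splits [1 - ez] into two sign components, and it lies in Delta
   by exchanging the roles of [z] and [h]. *)
have [eh [Deh Eh ehh eh2]] : exists eh : A, [/\ eh \in Delta,
    E h * eh = eh, eh * eh = eh & 2%:R *: eh = 1 + E h].
  exists (half h); split; rewrite ?half_fixed ?half_idem //.
    have hz : (h * z = z * h)%g by apply: (centsP abG); rewrite inE.
    have sw : perm_eq [:: 1; h; z; z * h]%g [:: 1; z; h; h * z]%g.
      by rewrite -hz perm_cons; exact/permEl/(perm_catCA [:: h] [:: z]).
    apply: (half_delta (k := z)) => // [|g]; first by rewrite (perm_uniq sw).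
    by rewrite (perm_mem sw).
  by rewrite scalerA mulfV // scale1r.
have Eh3 : E h * (1 - eh) = - (1 - eh) by exact: elt_subN.
have eh3_idem : (1 - eh) * (1 - eh) = 1 - eh by rewrite idem_sub ?mul1r.
have Dh3 : 1 - eh \in Delta by rewrite rpredB ?rpred1.
have at_mul e : e * e = e -> e \in Delta -> (E h * e = e \/ E h * e = - e) ->
    hereditary_at Delta (e * (1 - ez)).
  move=> ee De he; apply: hereditary_at_sign.
  - apply: (sign_eigen_gen all4).
      by right; rewrite mulAC -mulrA (mulAC _ (E z)) Ez3 mulrN.
    by rewrite mulrA; case: he => ->; [left | right; rewrite mulNr].
  - exact: idem_mul.
  - exact: rpredM.
  - by left; rewrite rmorphM /= aug_e3 mulr0.
pose e (i : 'I_4) :=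
  nth 0 [:: e1; ez - e1; eh * (1 - ez); (1 - eh) * (1 - ez)] i.
apply: (@hereditary_sum _ _ _ e).
  rewrite !big_ord_recl big_ord0 /e /= addr0 -mulrDl [eh + _]addrC subrK mul1r.
  by rewrite addrA (addrC e1) subrK addrC subrK.
by case=> [[|[|[|[|i]]]] Hi] //=; apply: at_mul => //; [left | right].
Qed.

End Order4.

Local Close Scope ring_scope.

Theorem corollary8p3 (p : nat) (p_pr : prime p) (gT : finGroupType)
    (G_pgroup : (p.-group [set: gT])%g) (G_neq1 : [set: gT] <> 1%g) :
  let Lambda := ZpG p_pr gT in
  let Gamma := idealizer (jacobson_of Lambda) in
  let Delta := idealizer (jacobson_of Gamma) in
  (hereditary (subring Gamma) <-> ([set: gT] \isog Zp p)%g) /\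
  ((p ^ 2 <= #|[set: gT]|)%N ->
     (hereditary (subring Delta) <-> #|[set: gT]| = 4)).
Proof.
move=> Lambda Gamma Delta.
have KO := padic_int_like p_pr.
have LE a : (a \in Lambda) =
    [forall g, a g \in @padic_integral_elt p p_pr] by [].
have p_gt1 := prime_gt1 p_pr.
have [_ p_dvd _] := pgroup_pdiv G_pgroup (introN eqP G_neq1).
rewrite cardsT in p_dvd.
split.
  split=> [hG|isoG].
    have cG := hereditary_gamma_card KO G_pgroup LE p_dvd hG.
    have cycG : cyclic [set: gT] by rewrite prime_cyclic // cardsT cG.
    have cycZ : cyclic (Zp p) by rewrite /Zp p_gt1 Zp_cycle cycle_cyclic.
    by rewrite isog_cyclic_card // cycZ card_Zp ?prime_gt0 // cardsT cG eqxx.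
  have cG : #|gT| = p by rewrite -cardsT (card_isog isoG) card_Zp ?prime_gt0.
  apply: (hereditary_gamma KO G_pgroup LE _ p_dvd cG).
  by apply: cyclic_abelian; rewrite prime_cyclic // cardsT cG.
rewrite cardsT => p2_le.
have p2_dvd : (p ^ 2 %| #|gT|)%N.
  have /p_natP[n cG] : p.-nat #|gT| by rewrite -cardsT.
  by move: p2_le; rewrite cG leq_exp2l // => /dvdn_exp2l ->.
split=> [|c4]; first exact: (hereditary_delta_card KO G_pgroup LE p_dvd p2_dvd).
have p2 : p = 2.
  apply/eqP; rewrite -(dvdn_prime2 p_pr) //.
  by move: p_dvd; rewrite c4 -[4]/(2 ^ 2)%N Euclid_dvdX // => /andP[].
subst p.
exact: (hereditary_delta KO LE c4).
Qed.
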